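(* Let $g:\mathbb{N}\to\mathbb{N}$ be a strictly increasing well-super-polynomial function, and let $f:\mathbb{N}\to\mathbb{N}$ be a sub-polynomial function with $f(g(n))\ge n$ (for all $n$). If ${\rm NP}\not\subseteq \mathrm{DTIME}(2^{n^{o(1)}})$, then for every ${\rm NP}$-complete language $A$, the language $\mathrm{pad}(A,g(n))$ belongs to $\mathrm{D}(2^{f(n)})$ and is not in $\mathrm{DTIME}(T(n))$, where $T:\mathbb{N}\to\mathbb{N}$ is an arbitrary function with $T(g(n))=2^{n^{o(1)}}$.
   Context: A function $g:\mathbb{N}\to\mathbb{N}$ is super-polynomial if for every constant $c>0$, $g(n)\ge n^c$ for all large $n$; a function $f$ is sub-polynomial if for every constant $c>0$, $f(n)\le n^c$ for all large $n$. A function $f$ is time constructible if given $n$, $f(n)$ can be computed in $O(f(n))$ steps by a deterministic Turing machine. A function $g$ is well-super-polynomial if $g$ is super-polynomial, time constructible, and there is a time constructible sub-polynomial function $f'$ such that $f'(g(n))\ge n$ for all sufficiently large $n$. For a language $A\subseteq\{0,1\}^*$, $\mathrm{pad}(A,g(n))=\{x10^{g(|x|)-|x|-1}: x\in A\}$. For a nondecreasing function $d$, $\mathrm{D}(d(n))$ is the class of languages $L$ with $|L^{\le n}|\le d(n)$ for all sufficiently large $n$, where $L^{\le n}$ is the set of strings in $L$ of length at most $n$. $\mathrm{DTIME}(t(n))$ is the class of languages decided by deterministic Turing machines in $O(t(n))$ time; $\mathrm{DTIME}(2^{n^{o(1)}})$ denotes languages decidable in deterministic time $2^{n^{\epsilon(n)}}$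 for some function $\epsilon(n)\to 0$.
   Formalization: The density bound proved is D(2^{f(n)+1}), not D(2^{f(n)}): A can have more than 2^n strings of length at most n while f(g(n)) = n, so the literal bound fails; f is taken nondecreasing, as the definition of D requires. *)

(* Defs.v *)
From Corelib Require Import PosDef.
From HB Require Import structures.
From mathcomp Require Import all_boot all_order all_algebra.
From mathcomp Require Import all_classical.
From mathcomp Require Import reals topology normedtype sequences exp.

Set Implicit Arguments.
Unset Strict Implicit.
Unset Printing Implicit Defensive.

Import Order.TTheory GRing.Theory Num.Theory.
Import numFieldNormedType.Exports.

Local Open Scope classical_set_scope.
Local Open Scope ring_scope.

Definition language := set (seq bool).

Definition strictly_increasing (g : nat -> nat) : Prop :=
  forall m n, (m < n)%N -> (g m < g n)%N.

Definition nondecreasing_nat (f : nat -> nat) : Prop :=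
  forall m n, (m <= n)%N -> (f m <= f n)%N.

(* Multitape Turing machines.  A tape symbol is the blank [None], an input bit,
   or one of finitely many further symbols [G]; tapes are infinite in both
   directions. *)

Definition symbol (G : finType) : Type := option (bool + G).

Inductive move : Type := MoveLeft | Stay | MoveRight.

Definition shift (d : move) : int :=
  match d with MoveLeft => -1 | Stay => 0 | MoveRight => 1 end.

Record tape (G : finType) : Type := Tape {
  cells : int -> symbol G;
  head : int }.

Definition blank_tape (G : finType) : tape G := Tape (fun=> None) 0.

(* The tape containing exactly [x], on cells 0, ..., |x| - 1, with the head on
   cell 0; it serves both as initial input tape and as final output tape. *)
Definition word_tape (G : finType) (x : seq bool) : tape G :=
  Tape (fun i => match i with
                 | Posz j => nth None [seq Some (inl b) | b <- x] j
                 | Negz _ => None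
                 end) 0.

Definition scanned (G : finType) (t : tape G) : symbol G := cells t (head t).

Definition update_tape (G : finType) (t : tape G) (a : symbol G * move) : tape G :=
  Tape (fun i => if i == head t then a.1 else cells t i) (head t + shift a.2).

(* Machines have k + 1 >= 1 tapes, so that an input tape always exists. *)
Record config (k : nat) (G Q : finType) : Type := Config {
  cstate : Q;
  ctapes : 'I_k.+1 -> tape G }.

Record action (k : nat) (G Q : finType) : Type := Action {
  next_state : Q;
  on_tape : 'I_k.+1 -> symbol G * move }.

Definition reads (k : nat) (G Q : finType) (c : config k G Q) :
  'I_k.+1 -> symbol G := fun j => scanned (ctapes c j).

Definition perform (k : nat) (G Q : finType) (c : config k G Q)
  (a : action k G Q) : config k G Q :=
  Config (next_state a) (fun j => update_tape (ctapes c j) (on_tape a j)).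

Definition init_config (k : nat) (G Q : finType) (q0 : Q) (x : seq bool) :
  config k G Q :=
  Config q0 (fun j => if j == ord0 then word_tape G x else blank_tape G).

Record dtm : Type := DTM {
  d_k : nat;
  d_sym : finType;
  d_state : finType;
  d_start : d_state;
  d_halting : pred d_state;
  d_accepting : pred d_state;
  d_delta : d_state -> ('I_d_k.+1 -> symbol d_sym) -> action d_k d_sym d_state }.

Definition d_config (M : dtm) : Type := config (d_k M) (d_sym M) (d_state M).

Definition d_step (M : dtm) (c : d_config M) : d_config M :=
  if d_halting (cstate c) then c
  else perform c (d_delta (cstate c) (reads c)).

Definition d_run (M : dtm) (x : seq bool) (s : nat) : d_config M :=
  iter s (@d_step M) (init_config _ _ (d_start M) x).

Definition halts_within (M : dtm) (x : seq bool) (s : nat) : Prop :=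
  d_halting (cstate (d_run M x s)).

Definition decides (M : dtm) (L : language) : Prop :=
  forall x, exists2 s, halts_within M x s &
    (d_accepting (cstate (d_run M x s)) <-> L x).

(* The output is read on the last tape. *)
Definition outputs (M : dtm) (x y : seq bool) (s : nat) : Prop :=
  halts_within M x s /\ ctapes (d_run M x s) ord_max = word_tape (d_sym M) y.

Definition DTIME (R : realType) (t : nat -> R) : set language :=
  [set L | exists M : dtm, decides M L /\
    exists C : R, \forall n \near \oo, forall x : seq bool, size x = n ->
      exists2 s : nat, s%:R <= C * t n & halts_within M x s].

(* t(n) = 2^(n^o(1)); as usual for asymptotic notation, the equality is only
   required for large n. *)
Definition is_two_pow_n_pow_o1 (R : realType) (t : nat -> R) : Prop :=
  exists eps : nat -> R, eps @ \oo --> (0 : R) /\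
    \forall n \near \oo, t n = 2 `^ (n%:R `^ eps n).

Definition DTIME_two_pow_n_pow_o1 (R : realType) : set language :=
  [set L | exists2 eps : nat -> R, eps @ \oo --> (0 : R) &
    DTIME (fun n => 2 `^ (n%:R `^ eps n)) L].

Record ntm : Type := NTM {
  n_k : nat;
  n_sym : finType;
  n_state : finType;
  n_start : n_state;
  n_accepting : pred n_state;
  n_delta : n_state -> ('I_n_k.+1 -> symbol n_sym) ->
    set (action n_k n_sym n_state) }.

Definition n_config (M : ntm) : Type := config (n_k M) (n_sym M) (n_state M).

Definition n_step (M : ntm) (c c' : n_config M) : Prop :=
  exists2 a, n_delta (cstate c) (reads c) a & c' = perform c a.

(* [n_run M x s c]: some computation of [M] on [x] is in [c] after s steps. *)
Fixpoint n_run (M : ntm) (x : seq bool) (s : nat) (c : n_config M) : Prop :=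
  match s with
  | 0%N => c = init_config _ _ (n_start M) x
  | s'.+1 => exists2 c', n_run x s' c' & n_step c' c
  end.

(* The time bound applies to every computation branch. *)
Definition NP : set language :=
  [set L | exists M : ntm,
    (exists e : nat, forall x s (c : n_config M),
       n_run x s c -> (s <= size x ^ e + e)%N) /\
    (forall x, L x <->
       exists s (c : n_config M), n_run x s c /\ n_accepting (cstate c))].

Definition poly_time_computable (r : seq bool -> seq bool) : Prop :=
  exists (M : dtm) (e : nat), forall x,
    exists2 s : nat, (s <= size x ^ e + e)%N & outputs M x (r x) s.

Definition poly_many_one_reducible (B A : language) : Prop :=
  exists2 r : seq bool -> seq bool, poly_time_computable r &
    forall x, B x <-> A (r x).

Definition NP_complete (A : language) : Prop :=
  NP A /\ forall B : language, NP B -> poly_many_one_reducible B A.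

(* Binary notation, most significant bit first. *)
Fixpoint bits_of_pos (p : positive) : seq bool :=
  match p with
  | xH => [:: true]
  | xO q => rcons (bits_of_pos q) false
  | xI q => rcons (bits_of_pos q) true
  end.

Definition binary (n : nat) : seq bool :=
  match bin_of_nat n with
  | N0 => [:: false]
  | Npos p => bits_of_pos p
  end.

(* Numbers are given and returned in binary: with a unary input no unbounded
   function that is o(n) would be time constructible, and no function would be
   well-super-polynomial. *)
Definition time_constructible (f : nat -> nat) : Prop :=
  exists M : dtm,
    (forall n, exists s, outputs M (binary n) (binary (f n)) s) /\
    exists C : nat, \forall n \near \oo, halts_within M (binary n) (C * f n)%N.

Definition super_polynomial (R : realType) (g : nat -> nat) : Prop :=
  forall c : R, 0 < c -> \forall n \near \oo, n%:R `^ c <= (g n)%:R.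

Definition sub_polynomial (R : realType) (f : nat -> nat) : Prop :=
  forall c : R, 0 < c -> \forall n \near \oo, (f n)%:R <= n%:R `^ c.

Definition well_super_polynomial (R : realType) (g : nat -> nat) : Prop :=
  [/\ super_polynomial R g,
      time_constructible g &
      exists f' : nat -> nat,
        [/\ time_constructible f', sub_polynomial R f' &
            \forall n \near \oo, (n <= f' (g n))%N]].

(* The subtraction is truncated, which matters only for the finitely many
   lengths n with g n <= n when g is super-polynomial. *)
Definition pad (A : language) (g : nat -> nat) : language :=
  [set y | exists2 x, A x &
    y = x ++ true :: nseq (g (size x) - size x - 1) false].

(* |L^{<= n}| <= d n for all large n; used for nondecreasing [d]. *)
Definition D (d : nat -> nat) : set language :=
  [set L | \forall n \near \oo,
    ([set x | L x /\ (size x <= n)%N] #<= `I_(d n))%card].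

(* Main.v *)
From Corelib Require Import PosDef.
Require Import Defs.
From mathcomp Require Import all_boot all_order all_algebra zify lra ring.
From mathcomp Require Import all_classical.
From mathcomp Require Import reals topology normedtype sequences exp.

(** Strings of [pad A g] of length at most [n] come from strings [x] with
    [|x| <= f (g |x|) <= f n], which gives the density bound.

    For the lower bound, let [M] decide [pad A g] in time [O(T)], and let [B] be
    in NP with a reduction [r] to [A].  For [y = r x] the natural algorithm
    computes [g |y|], writes down [y10...0] and runs [M] on it.  This is too slow
    when [g |y|] is much larger than the running time [h] of [M] on the padded
    word: well-super-polynomiality bounds [g] only from below.  In that case,
    however, [M] never reaches the end of the padding.  So the construction of
    the padding, which takes at most [C (g |y| + 1)] steps, is raced against a
    run of [M], slowed down by the factor [C], on [y] followed by a one and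
    lazily supplied zeros.  If [M] halts first, it has made at most [g |y|] steps
    and its answer is the one on the padded word; otherwise the padding was
    completed within [O(h)] steps and [M] is run on it.  The total time is
    [poly(|x|) + O(h) = 2^(|x|^o(1))]. *)

Set Implicit Arguments.
Unset Strict Implicit.
Unset Printing Implicit Defensive.

Import Order.TTheory GRing.Theory Num.Theory.
Import numFieldNormedType.Exports.
(* [seq.head] and other library names hide those of the definitions. *)
Import Defs.

(** * Multitape programs *)

Section Tapes.
Variable G : finType.
Implicit Types (t : tape G) (l r : seq (symbol G)).

Definition bit (b : bool) : symbol G := Some (inl b).
Definition bits (s : seq bool) : seq (symbol G) := [seq bit b | b <- s].

(* [l] lists the cells to the left of the head, nearest first; [r] lists the
   scanned cell and those to its right; all other cells are blank. *)
Definition rep t l r : Prop := forall i : int,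
  cells t (head t + i)%R =
  match i with Posz n => nth None r n | Negz n => nth None l n end.

Lemma rep_scanned t l r : rep t l r -> scanned t = nth None r 0.
Proof. by move=> /(_ 0%R); rewrite addr0. Qed.

(** Trailing blanks may be listed or omitted, so the lists describing a tape matter only up to
    [nth None]. *)
Lemma rep_ext t l r l' r' : nth None l =1 nth None l' ->
  nth None r =1 nth None r' -> rep t l r -> rep t l' r'.
Proof. by move=> hl hr h i; rewrite h; case: i => n; rewrite ?hl ?hr. Qed.

Lemma rep_word x : rep (word_tape G x) [::] (bits x).
Proof. by case=> n; rewrite ?add0r /= ?add0r ?nth_nil. Qed.

Lemma rep_blank : rep (blank_tape G) [::] [::].
Proof. by case=> n; rewrite /= nth_nil. Qed.

Lemma rep_stay t l r x : rep t l r ->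
  rep (update_tape t (x, Stay)) l (x :: behead r).
Proof.
move=> h i; rewrite /= addr0 h.
have -> : (head t + i == head t)%R = (i == 0%R) by lia.
by case: i => [[|n]|n] //=; rewrite nth_behead.
Qed.

Lemma rep_right t l r x : rep t l r ->
  rep (update_tape t (x, MoveRight)) (x :: l) (behead r).
Proof.
move=> h i; rewrite /= -addrA h.
have -> : (head t + (1 + i) == head t)%R = (i == Negz 0) by lia.
case: i => [n|[|n]] //; last by have -> : (1 + Negz n.+1 = Negz n)%R by lia.
have -> : (1 + n%:Z = Posz n.+1)%R by lia.
by rewrite nth_behead.
Qed.

Lemma rep_left t l r x : rep t l r ->
  rep (update_tape t (x, MoveLeft)) (behead l) (nth None l 0 :: x :: behead r).
Proof.
move=> h i; rewrite /= -addrA h.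
have -> : (head t + (-1 + i) == head t)%R = (i == Posz 1) by lia.
case: i => [[|[|n]]|n] //.
  have -> : (-1 + n.+2%:Z = Posz n.+1)%R by lia.
  by rewrite /= nth_behead.
have -> : (-1 + Negz n = Negz n.+1)%R by lia.
by rewrite nth_behead.
Qed.

Lemma update_tape_id t : update_tape t (scanned t, Stay) = t.
Proof.
case: t => c h; rewrite /update_tape /scanned /= addr0; congr Tape.
by apply/funext => i; case: eqP => // ->.
Qed.

End Tapes.

(** * Embedding of tape alphabets *)

Section Embedding.
Variables (G G' : finType) (e : G -> G').

Definition emb_sym (s : symbol G) : symbol G' :=
  match s with
  | None => None
  | Some (inl b) => Some (inl b)
  | Some (inr g) => Some (inr (e g))
  end.

(** A partial inverse found by search; symbols outside the image of [e] are read as blanks. *)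
Definition unemb_sym (s : symbol G') : symbol G :=
  match s with
  | None => None
  | Some (inl b) => Some (inl b)
  | Some (inr g) => omap inr [pick x | e x == g]
  end.

Lemma emb_symK : injective e -> cancel emb_sym unemb_sym.
Proof.
move=> e_inj [[b|g]|] //=; case: pickP => [x /eqP/e_inj -> //|].
by move/(_ g); rewrite eqxx.
Qed.

Lemma emb_bits x : [seq emb_sym s | s <- bits G x] = bits G' x.
Proof. by rewrite -map_comp. Qed.

(* Head positions are not required to agree: a machine cannot observe them. *)
Definition sim_tape (t : tape G) (t' : tape G') : Prop := forall i : int,
  cells t' (head t' + i)%R = emb_sym (cells t (head t + i)%R).

Lemma sim_scanned t t' : sim_tape t t' -> scanned t' = emb_sym (scanned t).
Proof. by move/(_ 0%R); rewrite !addr0. Qed.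

Lemma sim_update t t' a : sim_tape t t' ->
  sim_tape (update_tape t a) (update_tape t' (emb_sym a.1, a.2)).
Proof.
move=> h i; rewrite /= -!addrA h.
set j := (shift a.2 + i)%R.
have -> : (head t' + j == head t')%R = (j == 0%R) by lia.
have -> : (head t + j == head t)%R = (j == 0%R) by lia.
by case: eqP.
Qed.

Lemma nth_emb s n : nth None [seq emb_sym x | x <- s] n = emb_sym (nth None s n).
Proof. by elim: s n => [|a s IH] [|n] //=. Qed.

Lemma sim_rep t t' l r : sim_tape t t' -> rep t l r ->
  rep t' [seq emb_sym s | s <- l] [seq emb_sym s | s <- r].
Proof. by move=> h hr i; rewrite h hr; case: i => n; rewrite nth_emb. Qed.

Lemma rep_sim t t' l r : rep t l r ->
  rep t' [seq emb_sym s | s <- l] [seq emb_sym s | s <- r] -> sim_tape t t'.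
Proof. by move=> hr hr' i; rewrite hr hr'; case: i => n; rewrite nth_emb. Qed.

Lemma rep_sim_word x t' : rep t' [::] (bits G' x) -> sim_tape (word_tape G x) t'.
Proof. by rewrite -emb_bits => h; apply: rep_sim (rep_word _ _) h. Qed.

Lemma rep_sim_blank t' : rep t' [::] [::] -> sim_tape (blank_tape G) t'.
Proof. by move=> h; apply: rep_sim (rep_blank _) h. Qed.

End Embedding.

Arguments bit {G}.
Arguments bits {G}.

(** Tapes are indexed by an arbitrary type, so that combined programs use disjoint unions of tape
    sets and index arithmetic is avoided. *)
Record program (J : Type) (G : finType) : Type := Program {
  pstate : finType;
  pstart : pstate;
  phalt : pred pstate;
  pacc : pred pstate;
  pdelta : pstate -> (J -> symbol G) -> pstate * (J -> symbol G * move) }.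

Section Run.
Variables (J : Type) (G : finType).
Implicit Types (p : program J G) (t : J -> tape G).

Definition scan t : J -> symbol G := fun j => scanned (t j).
Definition act_on t (a : J -> symbol G * move) : J -> tape G :=
  fun j => update_tape (t j) (a j).
Definition idle (s : J -> symbol G) : J -> symbol G * move := fun j => (s j, Stay).

Definition pstep p (c : pstate p * (J -> tape G)) : pstate p * (J -> tape G) :=
  if phalt c.1 then c
  else ((pdelta c.1 (scan c.2)).1, act_on c.2 (pdelta c.1 (scan c.2)).2).

Definition run p n c := iter n (@pstep p) c.

Lemma act_on_idle t : act_on t (idle (scan t)) = t.
Proof. by apply/funext => j; rewrite /act_on update_tape_id. Qed.

Lemma runS p n c : run n.+1 c = run n (@pstep p c).
Proof. by rewrite /run iterSr. Qed.

Lemma run_step p n c : run n.+1 c = @pstep p (run n c).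
Proof. by []. Qed.

Lemma runD p m n (c : pstate p * (J -> tape G)) : run (m + n) c = run n (run m c).
Proof. by rewrite /run addnC iterD. Qed.

Lemma run_halted p n (c : pstate p * (J -> tape G)) : phalt c.1 -> run n c = c.
Proof. by move=> h; elim: n => //= n ->; rewrite /pstep h. Qed.

Lemma run_halted_le p m n (c : pstate p * (J -> tape G)) :
  phalt (run m c).1 -> m <= n -> run n c = run m c.
Proof. by move=> h /subnKC <-; rewrite runD run_halted. Qed.

(** The time [n] is only an upper bound, since a halted program keeps its configuration; [b] is the
    verdict. *)
Definition exec p t n (b : bool) t' : Prop := exists q,
  [/\ run n (pstart p, t) = (q, t'), phalt q & pacc q = b].

Definition reach p t n t' : Prop := exists b, exec p t n b t'.

Lemma exec_reach p t n b t' : exec p t n b t' -> reach p t n t'.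
Proof. by exists b. Qed.

Lemma exec_le p t m n b t' : exec p t m b t' -> m <= n -> exec p t n b t'.
Proof.
by move=> [q [e h1 h2]] le_mn; exists q; split=> //; rewrite (@run_halted_le _ m) // e.
Qed.

Lemma reach_le p t m n t' : reach p t m t' -> m <= n -> reach p t n t'.
Proof. by move=> [b h] le_mn; exists b; apply: exec_le h _. Qed.

End Run.

(** * Sequencing, sweeps and loops *)

Section Combinators.
Variables (J : Type) (G : finType).
Implicit Types (p : program J G) (t : J -> tape G).

Definition pseq p1 p2 : program J G :=
  @Program J G (pstate p1 + pstate p2)%type (inl (pstart p1))
    (fun q => if q is inr q2 then phalt q2 else false)
    (fun q => if q is inr q2 then pacc q2 else false)
    (fun q s => match q with
      | inl q1 => if phalt q1 then (inr (pstart p2), idle s)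
                  else (inl (pdelta q1 s).1, (pdelta q1 s).2)
      | inr q2 => (inr (pdelta q2 s).1, (pdelta q2 s).2)
      end).

(** The time [m] may be smaller than [n] because, inside [pseq], a halted [p1] hands over at once
    instead of idling. *)
Lemma pseq_run_l p1 p2 n q t q' t' : run n (q, t) = (q', t') -> phalt q' ->
  exists2 m, m <= n & run m (inl q : pstate (pseq p1 p2), t) = (inl q', t').
Proof.
elim: n q t => [|n IH] q t; first by case=> -> -> _; exists 0.
rewrite runS /pstep /=; case: ifP => hq.
  by rewrite run_halted // => -[<- <-] _; exists 0.
by move=> e h; have [m le_mn em] := IH _ _ e h; exists m.+1; rewrite // runS /pstep /= hq em.
Qed.

Lemma pseq_run_r p1 p2 n q t :
  run n (inr q : pstate (pseq p1 p2), t) = (inr (run n (q, t)).1, (run n (q, t)).2).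
Proof.
elim: n q t => [|n IH] q t //; rewrite !runS /pstep /=.
by case: ifP => hq; rewrite ?IH // !run_halted.
Qed.

Lemma exec_seq p1 p2 t m t1 n b t2 : reach p1 t m t1 -> exec p2 t1 n b t2 ->
  exec (pseq p1 p2) t (m + n.+1) b t2.
Proof.
move=> [_ [q1 [e1 h1 _]]] [q2 [e2 h2 hb]].
have [k le_km ek] := pseq_run_l p2 e1 h1.
apply: (@exec_le _ _ _ _ (k + n.+1)); last by lia.
exists (inr q2); split=> //=.
by rewrite runD ek runS /pstep /= h1 act_on_idle pseq_run_r e2.
Qed.

Lemma reach_seq p1 p2 t m t1 n t2 : reach p1 t m t1 -> reach p2 t1 n t2 ->
  reach (pseq p1 p2) t (m + n.+1) t2.
Proof. by move=> h1 [b h2]; exists b; apply: exec_seq h1 h2. Qed.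

Definition sweep (f : (J -> symbol G) -> option (J -> symbol G * move)) : program J G :=
  @Program J G bool false id xpred0
    (fun q s => if f s is Some a then (false, a) else (true, idle s)).

Lemma reach_sweep_stop f t : f (scan t) = None -> reach (sweep f) t 1 t.
Proof.
by move=> e; exists false, true; split; rewrite //= /pstep /= e act_on_idle.
Qed.

Lemma reach_sweep_step f t a n t' : f (scan t) = Some a ->
  reach (sweep f) (act_on t a) n t' -> reach (sweep f) t n.+1 t'.
Proof.
move=> e [b [q [h1 h2 h3]]]; exists b, q; split=> //.
by rewrite runS /pstep /= e.
Qed.

Definition act (f : (J -> symbol G) -> J -> symbol G * move) : program J G :=
  @Program J G bool false id xpred0 (fun q s => (true, f s)).

Lemma reach_act f t : reach (act f) t 1 (act_on t (f (scan t))).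
Proof. by exists false, true. Qed.

(* [None] tests the guard, [Some None] is the exit, [Some (Some q)] is the body. *)
Definition pwhile (c : pred (J -> symbol G)) p : program J G :=
  @Program J G (option (option (pstate p))) None
    (fun q => if q is Some None then true else false) xpred0
    (fun q s => match q with
      | None => (Some (if c s then Some (pstart p) else None), idle s)
      | Some (Some q) => if phalt q then (None, idle s)
                         else (Some (Some (pdelta q s).1), (pdelta q s).2)
      | Some None => (q, idle s)
      end).

Lemma pwhile_body c p n q t q' t' : run n (q, t) = (q', t') -> phalt q' ->
  exists2 m, m <= n &
    run m (Some (Some q) : pstate (pwhile c p), t) = (Some (Some q'), t').
Proof.
elim: n q t => [|n IH] q t; first by case=> -> -> _; exists 0.
rewrite runS /pstep /=; case: ifP => hq.
  by rewrite run_halted // => -[<- <-] _; exists 0.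
by move=> e h; have [m le_mn em] := IH _ _ e h; exists m.+1; rewrite // runS /pstep /= hq em.
Qed.

Lemma reach_while_stop c p t : ~~ c (scan t) -> reach (pwhile c p) t 1 t.
Proof.
move=> /negbTE e; exists false, (Some None); split=> //.
by rewrite /= /pstep /= e act_on_idle.
Qed.

Lemma reach_while_step (c : pred (J -> symbol G)) p t m t1 n t2 : c (scan t) -> reach p t m t1 ->
  reach (pwhile c p) t1 n t2 -> reach (pwhile c p) t (m + n).+2 t2.
Proof.
move=> e [_ [q1 [e1 h1 _]]] [b [q2 [e2 h2 hb]]].
have [k le_km ek] := pwhile_body c e1 h1.
apply: (@reach_le _ _ _ _ (k + n).+2); last by lia.
exists b, q2; split=> //.
rewrite -addnS runS /pstep /= e act_on_idle runD ek runS /pstep /= h1.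
by rewrite act_on_idle.
Qed.

End Combinators.

(** * Running a program on more tapes and symbols *)

Section Lift.
Variables (J J' : finType) (G G' : finType) (io : J -> J') (e : G -> G').
Hypotheses (io_inj : injective io) (e_inj : injective e).

Definition plift (p : program J G) : program J' G' :=
  @Program J' G' (pstate p) (pstart p) (@phalt _ _ p) (@pacc _ _ p)
    (fun q s => let d := pdelta q (fun j => unemb_sym e (s (io j))) in
      (d.1, fun j' => if [pick j | io j == j'] is Some j
                      then (emb_sym e (d.2 j).1, (d.2 j).2) else (s j', Stay))).

(** The last clause is a frame condition: data kept on tapes outside the image of [io] survives the
    call. *)
Lemma plift_run p n (q : pstate p) t t' : (forall j, sim_tape e (t j) (t' (io j))) ->
  exists t1', [/\ run n (q : pstate (plift p), t') = ((run n (q, t)).1, t1'),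
    forall j, sim_tape e ((run n (q, t)).2 j) (t1' (io j)) &
    forall j', (forall j, io j != j') -> t1' j' = t' j'].
Proof.
elim: n q t t' => [|n IH] q t t' h; first by exists t'.
rewrite !runS /pstep /=; case: ifP => hq; first by rewrite !run_halted //; exists t'.
have -> : (fun j => unemb_sym e (scan t' (io j))) = scan t.
  by apply/funext => j; rewrite /scan (sim_scanned (h j)) emb_symK.
set d := pdelta q (scan t); set a' := (X in act_on t' X).
have h1 j : sim_tape e (act_on t d.2 j) (act_on t' a' (io j)).
  rewrite /act_on /a'; case: pickP => [k /eqP/io_inj ->|/(_ j)]; last by rewrite eqxx.
  exact: sim_update.
have [t1' [e1 s1 f1]] := IH d.1 _ _ h1.
exists t1'; split=> // j' hj'; rewrite f1 // /act_on /a'.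
case: pickP => [j|_]; first by rewrite (negbTE (hj' j)).
exact: update_tape_id.
Qed.

Lemma exec_lift p n t b t1 t' : (forall j, sim_tape e (t j) (t' (io j))) ->
  exec p t n b t1 ->
  exists t1', [/\ exec (plift p) t' n b t1',
    forall j, sim_tape e (t1 j) (t1' (io j)) &
    forall j', (forall j, io j != j') -> t1' j' = t' j'].
Proof.
move=> h [q [e1 h1 hb]].
have [t1' [e2 s2 f2]] := plift_run n (pstart p) h.
rewrite e1 /= in e2 s2.
by exists t1'; split=> //; exists q.
Qed.

End Lift.

(** * Translation between programs and Turing machines *)

Section Machines.

Definition prog_of_dtm (M : dtm) : program 'I_(d_k M).+1 (d_sym M) :=
  @Program 'I_(d_k M).+1 (d_sym M) (d_state M) (d_start M) (@d_halting M) (@d_accepting M)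
    (fun q s => let a := d_delta q s in (next_state a, on_tape a)).

Definition dtm_of_prog (k : nat) (G : finType) (p : program 'I_k.+1 G) : dtm :=
  @DTM k G (pstate p) (pstart p) (@phalt _ _ p) (@pacc _ _ p)
    (fun q s => Action (pdelta q s).1 (pdelta q s).2).

Definition init_tapes (k : nat) (G : finType) (x : seq bool) : 'I_k.+1 -> tape G :=
  fun j => if j == ord0 then word_tape G x else blank_tape G.

Lemma run_prog_of_dtm M x n :
  run n (pstart (prog_of_dtm M), init_tapes (d_sym M) x) =
  (cstate (d_run M x n), ctapes (d_run M x n)).
Proof.
rewrite /run /d_run; elim: n => //= n ->; rewrite /pstep /d_step /=.
by case: ifP.
Qed.

Lemma run_dtm_of_prog k G (p : program 'I_k.+1 G) x n :
  run n (pstart p, init_tapes G x) =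
  (cstate (d_run (dtm_of_prog p) x n), ctapes (d_run (dtm_of_prog p) x n)).
Proof.
rewrite /run /d_run; elim: n => //= n ->; rewrite /pstep /d_step /=.
by case: ifP.
Qed.

Lemma exec_dtm_of_prog k G (p : program 'I_k.+1 G) x n b t :
  exec p (init_tapes G x) n b t ->
  halts_within (dtm_of_prog p) x n /\
  d_accepting (cstate (d_run (dtm_of_prog p) x n)) = b.
Proof.
by move=> [q [e hq <-]]; move: e; rewrite run_dtm_of_prog /halts_within => -[-> _].
Qed.

End Machines.

(** * Binary counters *)

(* Least significant bit first. *)
Fixpoint binc (u : seq bool) : seq bool :=
  match u with
  | [::] => [:: true]
  | false :: v => true :: v
  | true :: v => false :: binc v
  end.

Fixpoint bval (u : seq bool) : nat := if u is b :: v then b + (bval v).*2 else 0.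

Definition zeros (u : seq bool) : nat := count (pred1 false) u.

Lemma bits_of_pos_succ p : rev (bits_of_pos (Pos.succ p)) = binc (rev (bits_of_pos p)).
Proof. by elim: p => [p IH|p IH|] //=; rewrite !rev_rcons //= IH. Qed.

Lemma binary_succ n : rev (binary n.+1) = binc (rev (binary n)).
Proof.
rewrite /binary -{1}[n]bin_of_natK; case: (bin_of_nat n) => [|p] //.
rewrite (_ : (nat_of_bin (Npos p)).+1 = nat_of_bin (Npos (Pos.succ p))).
  by rewrite nat_of_binK bits_of_pos_succ.
by rewrite /= nat_of_succ_pos.
Qed.

Lemma bval_binc u : bval (binc u) = (bval u).+1.
Proof. by elim: u => [|[] u IH] //=; lia. Qed.

Lemma bval_binary n : bval (rev (binary n)) = n.
Proof. by elim: n => // n IH; rewrite binary_succ bval_binc IH. Qed.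

Lemma size_binc u : size (binc u) <= (size u).+1.
Proof. by elim: u => [|[] u IH] //=; lia. Qed.

Lemma size_binary n : size (binary n) <= n.+1.
Proof.
elim: n => // n IH; rewrite -size_rev binary_succ.
by apply: leq_trans (size_binc _) _; rewrite size_rev ltnS.
Qed.

(** Splits off the maximal initial block of [a]; the default [~~ a] lets an empty [u'] count as the
    end of the block. *)
Lemma constant_prefix a u : exists k u', u = nseq k a ++ u' /\ nth (~~ a) u' 0 = ~~ a.
Proof.
elim: u => [|b u [k [u' [e h]]]]; first by exists 0, [::].
have [->|ne] := eqVneq b a; last by exists 0, (b :: u); case: a b ne {h e} => [] [].
by exists k.+1, u'; rewrite e.
Qed.

Lemma binc_prefix k u : nth false u 0 = false ->
  binc (nseq k true ++ u) = nseq k false ++ true :: behead u.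
Proof. by elim: k => [|k IH] h /=; [case: u h => [|[]] | rewrite IH]. Qed.

Lemma zeros_cat u v : zeros (u ++ v) = zeros u + zeros v.
Proof. exact: count_cat. Qed.

Lemma zeros_nseq k a : zeros (nseq k a) = k * ~~ a.
Proof. by rewrite /zeros count_nseq; case: a; rewrite ?mul0n ?muln0 ?mul1n ?muln1. Qed.

Lemma zeros_size u : zeros u <= size u.
Proof. exact: count_size. Qed.

(** * Subroutines acting on one tape *)

Section Utilities.
Variables (J G : finType).
Implicit Types (t : J -> tape G) (j c m : J) (l r s w : seq (symbol G)).

Definition act1 j (f : symbol G -> symbol G * move) : program J G :=
  act (fun rd i => if i == j then f (rd j) else (rd i, Stay)).

Definition sweep1 j (f : symbol G -> option (symbol G * move)) : program J G :=
  sweep (fun rd => omap (fun a i => if i == j then a else (rd i, Stay)) (f (rd j))).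

Definition agree_off j t t' := forall i, i != j -> t' i = t i.

Lemma agree_off_trans j t1 t2 t3 :
  agree_off j t1 t2 -> agree_off j t2 t3 -> agree_off j t1 t3.
Proof. by move=> h1 h2 i ij; rewrite h2 // h1. Qed.

Lemma reach_act1 j f t : exists t', [/\ reach (act1 j f) t 1 t', agree_off j t t' &
  t' j = update_tape (t j) (f (scanned (t j)))].
Proof.
eexists; split; first exact: reach_act.
  by move=> i ij; rewrite /act_on (negbTE ij) update_tape_id.
by rewrite /act_on eqxx.
Qed.

Lemma reach_sweep1_stop j f t : f (scanned (t j)) = None -> reach (sweep1 j f) t 1 t.
Proof. by move=> e; apply: reach_sweep_stop; rewrite /scan e. Qed.

Lemma reach_sweep1_step j f t a : f (scanned (t j)) = Some a ->
  exists t1, [/\ agree_off j t t1, t1 j = update_tape (t j) a &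
    forall n t', reach (sweep1 j f) t1 n t' -> reach (sweep1 j f) t n.+1 t'].
Proof.
move=> e; exists (act_on t (fun i => if i == j then a else (scan t i, Stay))); split.
- by move=> i ij; rewrite /act_on (negbTE ij) update_tape_id.
- by rewrite /act_on eqxx.
- by move=> n t'; apply: reach_sweep_step; rewrite /scan e.
Qed.

Lemma nth_cat_congr s w w' : nth None w =1 nth None w' ->
  nth None (s ++ w) =1 nth None (s ++ w').
Proof. by move=> h i; rewrite !nth_cat h. Qed.

Lemma nth_hd_behead s : nth None (nth None s 0 :: behead s) =1 nth (None : symbol G) s.
Proof. by move=> [|i] /=; rewrite ?nth_behead. Qed.

Definition skip (d : move) : symbol G -> option (symbol G * move) :=
  fun x => if x is Some _ then Some (x, d) else None.

Lemma sweep_right j t l s w : rep (t j) l (s ++ w) -> all isSome s -> nth None w 0 = None ->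
  exists t', [/\ reach (sweep1 j (skip MoveRight)) t (size s).+1 t', agree_off j t t' &
    rep (t' j) (rev s ++ l) w].
Proof.
elim: s t l => [|a s IH] t l hr /= hs hw.
  by exists t; split=> //; apply: reach_sweep1_stop; rewrite (rep_scanned hr) hw.
case/andP: hs => ha hs; have e := rep_scanned hr.
have [|t1 [a1 e1 h1]] := @reach_sweep1_step j (skip MoveRight) t (a, MoveRight).
  by rewrite e; case: (a) ha.
have := rep_right a hr; rewrite -e1 => hr1.
have [t' [h2 a2 r2]] := IH t1 _ hr1 hs hw.
exists t'; split; [exact: h1 | exact: agree_off_trans a1 a2 |].
by rewrite rev_cons cat_rcons.
Qed.

(** Here [s] is listed leftwards starting with the scanned cell; when [s] is empty the head is
    already on a blank. *)
Lemma sweep_left j t s r : rep (t j) (behead s) (nth None s 0 :: r) -> all isSome s ->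
  exists t', [/\ reach (sweep1 j (skip MoveLeft)) t (size s).+1 t', agree_off j t t' &
    rep (t' j) [::] (None :: rev s ++ r)].
Proof.
elim: s t r => [|a s IH] t r hr /= hs.
  by exists t; split=> //; apply: reach_sweep1_stop; rewrite (rep_scanned hr).
case/andP: hs => ha hs; have e := rep_scanned hr.
have [|t1 [a1 e1 h1]] := @reach_sweep1_step j (skip MoveLeft) t (a, MoveLeft).
  by rewrite e; case: (a) ha.
have := rep_left a hr; rewrite -e1 /= => hr1.
have [t' [h2 a2 r2]] := IH t1 _ hr1 hs.
exists t'; split; [exact: h1 | exact: agree_off_trans a1 a2 |].
by rewrite rev_cons cat_rcons.
Qed.

Definition move1 j (d : move) : program J G := act1 j (fun x => (x, d)).

Definition rewind j : program J G :=
  pseq (move1 j MoveLeft) (pseq (sweep1 j (skip MoveLeft)) (move1 j MoveRight)).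

Lemma reach_rewind j t l r : rep (t j) l r -> all isSome l ->
  exists t', [/\ reach (rewind j) t (size l + 6) t', agree_off j t t' &
    rep (t' j) [::] (rev l ++ r)].
Proof.
move=> hr hl.
have [t1 [h1 a1 e1]] := reach_act1 j (fun x => (x, MoveLeft)) t.
have := rep_left (scanned (t j)) hr; rewrite -e1 => hr1.
have [t2 [h2 a2 hr2]] := sweep_left hr1 hl.
have [t3 [h3 a3 e3]] := reach_act1 j (fun x => (x, MoveRight)) t2.
exists t3; split.
- by apply: reach_le (reach_seq h1 (reach_seq h2 h3)) _; lia.
- exact: agree_off_trans (agree_off_trans a1 a2) a3.
- have := rep_right (scanned (t2 j)) hr2; rewrite -e3 (rep_scanned hr2) /=.
  apply: rep_ext; first by move=> [|i] /=; rewrite ?nth_nil.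
  by apply: nth_cat_congr; rewrite (rep_scanned hr); apply: nth_hd_behead.
Qed.

Definition flip (a : bool) : symbol G -> option (symbol G * move) :=
  fun x => if x is Some (inl b) then
             if b == a then Some (bit (~~ a), MoveLeft) else None
           else None.

(** Numbers are written most significant bit first, so [u], least significant bit first, is read
    leftwards from the head; [w] lies to the right of the head. *)
Definition at_lsb (t : tape G) (u : seq bool) w :=
  rep t (behead (bits u)) (nth None (bits u) 0 :: w).

Lemma sweep_flip j a t k u w : at_lsb (t j) (nseq k a ++ u) w -> nth (~~ a) u 0 = ~~ a ->
  exists t', [/\ reach (sweep1 j (flip a)) t k.+1 t', agree_off j t t' &
    at_lsb (t' j) u (bits (nseq k (~~ a)) ++ w)].
Proof.
elim: k t w => [|k IH] t w hr hu; have e := rep_scanned hr.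
  exists t; split=> //; apply: reach_sweep1_stop; rewrite e.
  by case: (u) hu => //= b _ ->; case: (a).
have [|t1 [a1 e1 h1]] := @reach_sweep1_step j (flip a) t (bit (~~ a), MoveLeft).
  by rewrite e /= eqxx.
have := rep_left (bit (~~ a)) hr; rewrite -e1 /= => hr1.
have [t' [h2 a2 r2]] := IH t1 _ hr1 hu.
exists t'; split; [exact: h1 | exact: agree_off_trans a1 a2 |].
apply: rep_ext r2 => //= -[|i] //=; congr (nth _ _ _).
by elim: (k) => //= n ->.
Qed.

Definition to_lsb j : program J G :=
  pseq (sweep1 j (skip MoveRight)) (move1 j MoveLeft).

Lemma all_isSome_bits u : all isSome (bits u : seq (symbol G)).
Proof. by elim: u. Qed.

Lemma bits_cat u v : bits (u ++ v) = bits u ++ bits v :> seq (symbol G).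
Proof. exact: map_cat. Qed.

Lemma bits_rev u : bits (rev u) = rev (bits u) :> seq (symbol G).
Proof. exact: map_rev. Qed.

Lemma size_bits u : size (bits u : seq (symbol G)) = size u.
Proof. exact: size_map. Qed.

Lemma reach_to_lsb j t u v : rep (t j) (bits u) (bits v) ->
  exists t', [/\ reach (to_lsb j) t (size v + 3) t', agree_off j t t' &
    at_lsb (t' j) (rev v ++ u) [::]].
Proof.
rewrite -[bits v]cats0 => hr.
have [t1 [h1 a1 hr1]] := sweep_right hr (all_isSome_bits v) erefl.
have [t2 [h2 a2 e2]] := reach_act1 j (fun x => (x, MoveLeft)) t1.
exists t2; split.
- by apply: reach_le (reach_seq h1 h2) _; rewrite size_bits; lia.
- exact: agree_off_trans a1 a2.
- have := rep_left (scanned (t1 j)) hr1; rewrite -e2 (rep_scanned hr1) /= /at_lsb.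
  by rewrite bits_cat bits_rev; apply: rep_ext => // -[|[|i]] /=; rewrite ?nth_nil.
Qed.

Definition incr j : program J G :=
  pseq (sweep1 j (flip true)) (pseq (act1 j (fun=> (bit true, Stay))) (to_lsb j)).

(** The carry stops at the lowest zero, or at the blank beyond the top bit; a one is written there
    and the head walks back. *)
Lemma reach_incr j t u : at_lsb (t j) u [::] ->
  exists t', [/\ reach (incr j) t (size u + size u + 9) t', agree_off j t t' &
    at_lsb (t' j) (binc u) [::]].
Proof.
have [k [u' [eu hu]]] := constant_prefix true u; rewrite /= in hu.
rewrite eu => hr.
have [t1 [h1 a1 hr1]] := sweep_flip hr hu.
have [t2 [h2 a2 e2]] := reach_act1 j (fun=> (bit true, Stay)) t1.
have := rep_stay (bit true) hr1; rewrite -e2 /= cats0 => hr2.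
have {}hr2 : rep (t2 j) (bits (behead u')) (bits (true :: nseq k false)).
  by move: hr2; rewrite /bits behead_map.
have [t3 [h3 a3 hr3]] := reach_to_lsb hr2.
exists t3; split.
- apply: reach_le (reach_seq h1 (reach_seq h2 h3)) _.
  by rewrite /= size_cat !size_nseq; lia.
- exact: agree_off_trans (agree_off_trans a1 a2) a3.
- move: hr3; rewrite binc_prefix // rev_cons cat_rcons.
  by rewrite rev_nseq.
Qed.

End Utilities.

Lemma bval_pred k v :
  (bval (nseq k true ++ false :: v)).+1 = bval (nseq k false ++ true :: v).
Proof. by elim: k => //= k <-; lia. Qed.

(** * Writing the padding with a decreasing counter *)

Section Padding.
Variables (J G : finType) (c m : J).
Hypothesis neq_cm : c != m.
Implicit Types (t : J -> tape G) (l r : seq (symbol G)).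

(** Goes to the least significant bit and borrows through the low zeros. The head ends on the lowest
    one, or on a blank when the counter is zero, so a single scan tests for zero. *)
Definition settle : program J G := pseq (to_lsb G c) (sweep1 c (flip false)).

Lemma reach_settle t u v k u' : rep (t c) (bits u) (bits v) ->
  rev v ++ u = nseq k false ++ u' -> nth true u' 0 = true ->
  exists t', [/\ reach settle t (size v + k + 5) t', agree_off c t t' &
    at_lsb (t' c) u' (bits (nseq k true))].
Proof.
move=> hr e hu.
have [t1 [h1 a1 hr1]] := reach_to_lsb hr; rewrite e in hr1.
have [t2 [h2 a2 hr2]] := sweep_flip hr1 hu; rewrite cats0 in hr2.
exists t2; split=> //; last exact: agree_off_trans a1 a2.
by apply: reach_le (reach_seq h1 h2) _; lia.
Qed.

(** Completes the pending decrement while the head of [m] advances. Cells already written are kept,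
    so the counter measures the total length of the padded word and no subtraction has to be
    computed. *)
Definition fill_action (rd : J -> symbol G) (i : J) : symbol G * move :=
  if i == c then (bit false, MoveRight)
  else if i == m then (if rd m is None then bit false else rd m, MoveRight)
  else (rd i, Stay).

Definition fill_loop : program J G :=
  pwhile (fun rd => if rd c is Some (inl true) then true else false)
    (pseq (act fill_action) settle).

(* When the counter holds [nseq k false ++ u] (least significant bit first) the
   head is on the first bit of [u] and the [k] low zeros have been borrowed from,
   i.e. replaced by ones.  The potential [k + 2 * zeros u] pays for the walks. *)
Lemma reach_fill_loop V t k u l r : bval (nseq k false ++ u) = V ->
  nth true u 0 = true -> at_lsb (t c) u (bits (nseq k true)) ->
  rep (t m) l r -> all isSome l -> all isSome r ->
  exists t' l' r', [/\ reach fill_loop t (12 * V + k + 2 * zeros u + 1) t',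
    forall i, i != c -> i != m -> t' i = t i, rep (t' m) l' r',
    all isSome l' & size l' = size l + V /\
    rev l' ++ r' = rev l ++ r ++ nseq (V - size r) (bit false)].
Proof.
elim: V t k u l r => [|V IH] t k [|b v] l r hV hu hc hm hl hr.
- exists t, l, r; split=> //; last by rewrite addn0 cats0.
  apply: reach_le (reach_while_stop _ _) _; last by lia.
  by rewrite /scan (rep_scanned hc).
- by move: hV; rewrite (_ : b = true) // -bval_pred.
- move: hV; rewrite cats0.
  by have -> : bval (nseq k false) = 0 by elim: (k) => //= n ->.
have eb : b = true by []; rewrite {}eb {b} in hV hu hc *.
have hV1 : bval (nseq k true ++ false :: v) = V by move: hV; rewrite -bval_pred => -[].
have h1 := reach_act fill_action t.
set t1 := act_on t _ in h1.
have c1 : rep (t1 c) (bits (false :: v)) (bits (nseq k true)).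
  by have := rep_right (bit false) hc; rewrite /t1 /act_on /fill_action eqxx.
set x := if nth None r 0 is None then bit false else nth None r 0.
have m1 : rep (t1 m) (x :: l) (behead r).
  have := rep_right x hm; rewrite /t1 /act_on /fill_action eqxx eq_sym (negbTE neq_cm).
  by rewrite /scan (rep_scanned hm).
have o1 i : i != c -> i != m -> t1 i = t i.
  by move=> /negbTE ic /negbTE im; rewrite /t1 /act_on /fill_action ic im update_tape_id.
(* The decremented counter is split at its lowest one; its [k2] low zeros are borrowed from next. *)
have [k2 [u2 []]] := constant_prefix false (nseq k true ++ false :: v).
rewrite [~~ false]/= => eu2 hu2.
have [|t2 [h2 a2 c2]] := reach_settle (k := k2) c1 _ hu2; first by rewrite rev_nseq eu2.
have m2 : rep (t2 m) (x :: l) (behead r) by rewrite a2 // eq_sym.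
have [|||t' [l' [r' [h3 o3 m3 hl' [sl' e']]]]] := IH t2 k2 u2 (x :: l) (behead r) _ hu2 c2 m2.
- by rewrite -eu2.
- by rewrite /= hl andbT /x; case: (nth None r 0).
- by case: (r) hr => //= ? ? /andP[].
exists t', l', r'; split=> //.
- apply: reach_le (reach_while_step _ (reach_seq h1 h2) h3) _.
    by rewrite /scan (rep_scanned hc).
  (* A decrement creates one zero, so [k2 + zeros u2 = zeros v + 1]. The [k2] cells are paid for
     twice, in this round and in the potential left for the next one, which adds up to 12 steps per
     unit of the counter. *)
  have : zeros (nseq k true ++ false :: v) = (zeros v).+1.
    by rewrite zeros_cat zeros_nseq muln0.
  by rewrite eu2 zeros_cat zeros_nseq /= size_nseq /zeros /=; lia.
- by move=> i ic im; rewrite o3 // a2 // o1.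
- split; first by rewrite sl' /=; lia.
  rewrite e' rev_cons cat_rcons /x; congr (_ ++ _).
  by case: (r) hr => [|[a|] r0] //= _; rewrite subn0.
Qed.

Definition pad_prog : program J G := pseq settle (pseq fill_loop (rewind G m)).

(** By amortization the time is linear in [V], without a factor for the number of its digits; the
    race needs this linear bound. *)
Lemma reach_pad t V y : rep (t c) [::] (bits (binary V)) -> rep (t m) [::] (bits y) ->
  exists t', [/\ reach pad_prog t (18 * V + 18) t',
    forall i, i != c -> i != m -> t' i = t i &
    rep (t' m) [::] (bits (y ++ nseq (V - size y) false))].
Proof.
move=> hc hm.
have [k [u [eu hu]]] := constant_prefix false (rev (binary V)); rewrite /= in hu.
have [|t1 [h1 a1 c1]] := reach_settle (u := [::]) (k := k) hc _ hu; first by rewrite cats0 eu.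
have m1 : rep (t1 m) [::] (bits y) by rewrite a1 // eq_sym.
have [|t2 [l [r [h2 o2 m2 hl [sl e]]]]] := reach_fill_loop (V := V) _ hu c1 m1 isT (all_isSome_bits _ _).
  by rewrite -eu bval_binary.
have [t3 [h3 a3 m3]] := reach_rewind m2 hl.
exists t3; split.
- apply: reach_le (reach_seq h1 (reach_seq h2 h3)) _.
  have := size_binary V; have := zeros_size (rev (binary V)); rewrite size_rev.
  have := congr1 zeros eu; rewrite zeros_cat zeros_nseq /= sl /=.
  by lia.
- by move=> i ic im; rewrite a3 // o2 // a1.
- by move: m3; rewrite e size_bits bits_cat /= /bits map_nseq.
Qed.

End Padding.

(** * Copying the word twice and counting its length *)

Section Preparation.
Variables (J G : finType) (s m v c : J).
Hypothesis uniq_smvc : uniq [:: s; m; v; c].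
Implicit Types (t : J -> tape G) (y : seq bool).

Definition copy_action (rd : J -> symbol G) (i : J) : symbol G * move :=
  if i \in [:: s; m; v] then (rd s, MoveRight) else (rd i, Stay).

Definition copy_loop : program J G :=
  pwhile (fun rd => isSome (rd s)) (pseq (act copy_action) (incr G c)).

Lemma c_notin : (c \in [:: s; m; v]) = false.
Proof.
move: uniq_smvc; rewrite (_ : [:: s; m; v; c] = rcons [:: s; m; v] c) //.
by rewrite rcons_uniq => /andP[/negbTE].
Qed.

Lemma neq_c i : i \in [:: s; m; v] -> i != c.
Proof. by move=> hi; apply/eqP => e; have := c_notin; rewrite -e hi. Qed.

Lemma reach_copy_loop y2 y1 t l : rep (t s) l (bits y2) ->
  rep (t m) (bits (rev y1)) [::] -> rep (t v) (bits (rev y1)) [::] ->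
  at_lsb (t c) (rev (binary (size y1))) [::] ->
  exists t', [/\ reach copy_loop t (size y2 * (2 * (size y1 + size y2) + 20) + 1) t',
    forall i, i \notin [:: s; m; v; c] -> t' i = t i,
    rep (t' m) (bits (rev (y1 ++ y2))) [::], rep (t' v) (bits (rev (y1 ++ y2))) [::] &
    at_lsb (t' c) (rev (binary (size (y1 ++ y2)))) [::]].
Proof.
elim: y2 y1 t l => [|b y2 IH] y1 t l hs hm hv hc.
  exists t; split=> //; rewrite ?cats0 //.
  by apply: reach_while_stop; rewrite /scan (rep_scanned hs).
have h1 := reach_act copy_action t.
set t1 := act_on t _ in h1.
have f1 i : i \in [:: s; m; v] -> t1 i = update_tape (t i) (bit b, MoveRight).
  by move=> hi; rewrite /t1 /act_on /copy_action hi /scan (rep_scanned hs).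
have s1 : rep (t1 s) (bit b :: l) (bits y2).
  by rewrite f1 ?inE ?eqxx //; apply: rep_right hs.
have m1 : rep (t1 m) (bits (rev (rcons y1 b))) [::].
  by rewrite f1 ?inE ?eqxx ?orbT // rev_rcons; apply: rep_right hm.
have v1 : rep (t1 v) (bits (rev (rcons y1 b))) [::].
  by rewrite f1 ?inE ?eqxx ?orbT // rev_rcons; apply: rep_right hv.
have o1 i : i \notin [:: s; m; v] -> t1 i = t i.
  by move=> /negbTE hi; rewrite /t1 /act_on /copy_action hi update_tape_id.
have c1 : at_lsb (t1 c) (rev (binary (size y1))) [::] by rewrite o1 // c_notin.
have [t2 [h2 a2 c2]] := reach_incr c1; rewrite -binary_succ in c2.
have [||||t3 [h3 o3 m3 v3 c3]] := IH (rcons y1 b) t2 (bit b :: l).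
- by rewrite a2 // neq_c // !inE eqxx.
- by rewrite a2 // neq_c // !inE eqxx !orbT.
- by rewrite a2 // neq_c // !inE eqxx !orbT.
- by rewrite size_rcons.
exists t3; rewrite -cat_rcons; split=> //.
- apply: reach_le (reach_while_step _ (reach_seq h1 h2) h3) _.
    by rewrite /scan (rep_scanned hs).
  have := size_binary (size y1); rewrite size_rev size_rcons /=; nia.
- move=> i hi; rewrite o3 // a2 ?o1 //.
    by apply: contra hi; rewrite !inE => /or3P[] ->; rewrite ?orbT.
  by apply: contra hi; rewrite !inE => ->; rewrite !orbT.
Qed.

Definition mark_action (rd : J -> symbol G) (i : J) : symbol G * move :=
  (if i \in [:: m; v] then bit true else rd i, Stay).

Definition prepare : program J G :=
  pseq (act1 c (fun=> (bit false, Stay)))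
    (pseq copy_loop (pseq (act mark_action) (pseq (rewind G c) (pseq (rewind G m) (rewind G v))))).

Lemma reach_prepare t y : rep (t s) [::] (bits y) -> rep (t m) [::] [::] ->
  rep (t v) [::] [::] -> rep (t c) [::] [::] ->
  exists t', [/\ reach prepare t (2 * size y ^ 2 + 30 * size y + 50) t',
    forall i, i \notin [:: s; m; v; c] -> t' i = t i,
    rep (t' m) [::] (bits (rcons y true)), rep (t' v) [::] (bits (rcons y true)) &
    rep (t' c) [::] (bits (binary (size y)))].
Proof.
move=> hs hm hv hc.
have mc : m != c by rewrite neq_c // !inE eqxx !orbT.
have vc : v != c by rewrite neq_c // !inE eqxx !orbT.
have sc : s != c by rewrite neq_c // !inE eqxx.
have mv : m != v.
  by move: uniq_smvc => /= /and4P[_]; rewrite !inE negb_or => /andP[].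
have [t1 [h1 a1 e1]] := reach_act1 c (fun=> (bit false, Stay)) t.
(* [binary 0] is the digit zero and not the empty word, hence the digit written first. *)
have c1 : at_lsb (t1 c) (rev (binary 0)) [::].
  by rewrite e1; apply: rep_stay hc.
have [||||t2 [h2 o2 m2 v2 c2]] := @reach_copy_loop y [::] t1 [::].
- by rewrite a1.
- by rewrite a1.
- by rewrite a1.
- exact: c1.
rewrite /= in m2 v2 c2.
have h3 := reach_act mark_action t2.
set t3 := act_on t2 _ in h3.
have f3 i : i \in [:: m; v] -> t3 i = update_tape (t2 i) (bit true, Stay).
  by move=> hi; rewrite /t3 /act_on /mark_action hi.
have o3 i : i \notin [:: m; v] -> t3 i = t2 i.
  by move=> /negbTE hi; rewrite /t3 /act_on /mark_action hi update_tape_id.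
have m3 : rep (t3 m) (bits (rev y)) [:: bit true].
  by rewrite f3 ?inE ?eqxx //; apply: rep_stay m2.
have v3 : rep (t3 v) (bits (rev y)) [:: bit true].
  by rewrite f3 ?inE ?eqxx ?orbT //; apply: rep_stay v2.
have c3 : at_lsb (t3 c) (rev (binary (size y))) [::].
  by rewrite o3 // !inE negb_or eq_sym mc eq_sym vc.
have hb : all isSome (behead (bits (rev (binary (size y))) : seq (symbol G))).
  by rewrite /bits behead_map all_isSome_bits.
have [t4 [h4 a4 c4]] := reach_rewind c3 hb.
have m4 : rep (t4 m) (bits (rev y)) [:: bit true] by rewrite a4.
have [t5 [h5 a5 m5]] := reach_rewind m4 (all_isSome_bits _ _).
have v5 : rep (t5 v) (bits (rev y)) [:: bit true] by rewrite a5 1?eq_sym // a4.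
have [t6 [h6 a6 v6]] := reach_rewind v5 (all_isSome_bits _ _).
have e6 : rev (bits (rev y)) ++ [:: bit true] = bits (rcons y true) :> seq (symbol G).
  by rewrite -bits_rev revK -cats1 bits_cat.
exists t6; split.
- apply: reach_le (reach_seq h1 (reach_seq h2 (reach_seq h3
    (reach_seq h4 (reach_seq h5 h6))))) _.
  have := size_binary (size y).
  rewrite size_behead !size_bits !size_rev /= add0n; nia.
- move=> i; rewrite !inE !negb_or => /and4P[ns nm nv nc].
  rewrite a6 // a5 // a4 // o3 ?inE ?negb_or ?nm // o2 ?a1 //.
  by rewrite !inE !negb_or ns nm nv.
- by rewrite a6 // -e6.
- by rewrite -e6.
- rewrite a6 1?eq_sym // a5 1?eq_sym //; move: c4.
  rewrite -[in bits (binary _)](revK (binary (size y))).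
  (* Since [binary] is never empty, the scanned cell is its last digit and not a blank. *)
  set w := rev (binary _); have : 0 < size w.
    rewrite size_rev; move: (bval_binary (size y)) => _.
    by rewrite /binary; case: bin_of_nat => // -[p|p|] //=; rewrite size_rcons.
  by case: w => //= b w _; rewrite bits_rev /= rev_cons -cats1.
Qed.

End Preparation.

(** * Lazy padding *)

Section Lazy.
Variables (J G : finType) (p : program J G) (j0 : J).

(* The extra symbol stands for a blank written by the machine, so that a blank
   cell is always an unvisited one. *)
Definition enlazy (s : symbol G) : symbol (G + unit)%type :=
  match s with
  | None => Some (inr (inr tt))
  | Some (inl b) => Some (inl b)
  | Some (inr g) => Some (inr (inl g))
  end.

Definition unlazy (s : symbol (G + unit)%type) : symbol G :=
  match s with
  | Some (inl b) => Some (inl b)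
  | Some (inr (inl g)) => Some (inr g)
  | _ => None
  end.

Lemma enlazyK : cancel enlazy unlazy. Proof. by case=> [[]|]. Qed.

Definition lazy_read (left : bool) (rd : J -> symbol (G + unit)%type) : J -> symbol G :=
  fun j => if [&& j == j0, ~~ isSome (rd j) & ~~ left] then bit false
           else unlazy (rd j).

(* Runs [p] as if the word on tape [j0] were followed by infinitely many zeros.
   The visited cells form an interval, so an unvisited cell is to the right of
   the word exactly when it is entered by a move to the right; the boolean
   records whether the last move on tape [j0] was to the left. *)
Definition lazy_prog : program J (G + unit)%type :=
  @Program J (G + unit)%type (pstate p * bool)%type (pstart p, false)
    (fun q => phalt q.1) (fun q => pacc q.1)
    (fun q rd => let d := pdelta q.1 (lazy_read q.2 rd) in
      ((d.1, match (d.2 j0).2 with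
             | MoveLeft => true | MoveRight => false | Stay => q.2 end),
       fun j => (enlazy (d.2 j).1, (d.2 j).2))).

Definition lazy_other (t : tape G) (t' : tape (G + unit)%type) : Prop :=
  head t' = head t /\ forall i, unlazy (cells t' i) = cells t i.

(** The invariant after [s] steps: the nonblank cells of the lazy tape form the interval from [a] to
    [b], and the head is in it or next to it, on the side given by [left]. Beyond [b] the true tape
    must hold zeros only below [len], and the head is not beyond [s]. *)
Definition lazy_input (len s : nat) (left : bool) (t : tape G)
    (t' : tape (G + unit)%type) : Prop :=
  [/\ head t' = head t, (head t <= s%:Z)%R & exists a b : int,
    [/\ (a <= b)%R, (a - 1 <= head t <= b + 1)%R,
      (head t = a - 1)%R -> left, (head t = b + 1)%R -> ~~ left &
      forall i : int, [/\ (a <= i <= b)%R -> isSome (cells t' i) /\ unlazy (cells t' i) = cells t i,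
        (i < a)%R -> cells t' i = None /\ cells t i = None &
        (b < i)%R -> cells t' i = None /\ ((i < len%:Z)%R -> cells t i = bit false)]]].

Lemma lazy_input_update len s left t t' w mv : lazy_input len s left t t' ->
  lazy_input len s.+1 (match mv with
             | MoveLeft => true | MoveRight => false | Stay => left end)
    (update_tape t (w, mv)) (update_tape t' (enlazy w, mv)).
Proof.
case=> eh hs [a [b [ab hab hl hr hi]]].
have sh : (-1 <= shift mv <= 1)%R by case: mv.
split; rewrite /= ?eh //; first by lia.
(* The cell just written joins the interval. *)
exists (Order.min a (head t)), (Order.max b (head t)); split; first by lia.
- by lia.
- by case: mv sh => //= _; lia.
- by case: mv sh => //= _; lia.
- move=> i; have [h1 h2 h3] := hi i; have [->|ne] := eqVneq i (head t).
    by rewrite enlazyK; split; [case: w {h1 h2 h3} => [[]|] | lia | lia].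
  split=> h; [apply: h1; lia | apply: h2; lia | apply: h3; lia].
Qed.

Lemma lazy_input_read len s left t t' j : lazy_input len s left t t' -> s < len ->
  (if [&& j == j0, ~~ isSome (scanned t') & ~~ left] then bit false
   else unlazy (scanned t')) =
  (if j == j0 then scanned t else unlazy (scanned t')).
Proof.
case=> eh hs [a [b [ab hab hl hr hi]]] lt_s; case: eqP => //= _.
rewrite /scanned eh; have [h1 h2 h3] := hi (head t).
have [lt|ge] := ltP (head t) a.
  by have [-> ->] := h2 lt; rewrite hl //; lia.
have [gt|le] := ltP b (head t).
  by have [-> ->] := h3 gt; rewrite ?hr //; lia.
have [|] := h1; first by lia.
by case: (cells t' _) => //= x _ ->.
Qed.

Lemma lazy_run len s t t' : lazy_input len 0 false (t j0) (t' j0) ->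
  (forall j, j != j0 -> lazy_other (t j) (t' j)) -> s <= len ->
  (run s (pstart lazy_prog, t')).1.1 = (run s (pstart p, t)).1.
Proof.
move=> h0 hoth le_s.
pose c := run s (pstart p, t); pose c' := run s (pstart lazy_prog, t').
suff [] : [/\ c'.1.1 = c.1, lazy_input len s c'.1.2 (c.2 j0) (c'.2 j0) &
  forall j, j != j0 -> lazy_other (c.2 j) (c'.2 j)] by [].
rewrite {}/c {}/c'; elim: s le_s => // s IH le_s.
have [|e1 e2 e3] := IH _; first by lia.
rewrite !run_step.
case: (run s _) e1 e2 e3 => -[q2 lf] t2; case: (run s _) => q1 t1 /= -> h1 h2.
rewrite /pstep /=; case: ifP => hq.
  split=> //; case: h1 => eh hs hab; split=> //=; lia.
have -> : lazy_read lf (scan t2) = scan t1.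
  apply/funext => j; rewrite /lazy_read.
  have [->|ne] := eqVneq j j0.
    by have := lazy_input_read j0 h1 le_s; rewrite eqxx.
  by have [eh ec] := h2 _ ne; rewrite /= /scan /scanned eh ec.
set d := pdelta _ _; split=> //=.
  by rewrite /act_on; case: (d.2 j0) => w mv; apply: lazy_input_update h1.
move=> j ne; have [eh ec] := h2 _ ne; rewrite /act_on; split=> /=; first by rewrite eh.
by move=> i; rewrite eh; case: eqP => // _; rewrite enlazyK.
Qed.

End Lazy.

Lemma lazy_run_word k G (p : program 'I_k.+1 G) y n s : 0 < size y ->
  s <= size y + n ->
  (run s (pstart (lazy_prog p ord0), init_tapes (G + unit)%type y)).1.1 =
  (run s (pstart p, init_tapes G (y ++ nseq n false))).1.
Proof.
move=> y0 le_s; apply: (@lazy_run _ _ _ _ (size y + n)) => //; last first.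
  by move=> j /negbTE ne; rewrite /init_tapes ne.
(* Initially the interval is the word [y] itself, nonempty because [0 < size y]. *)
rewrite /init_tapes eqxx; split=> //; exists 0%R, (Posz (size y).-1); split=> //.
case=> i; split=> //=; try lia.
- move=> hi; have lt_i : i < size y by lia.
  rewrite map_cat nth_cat size_map lt_i (nth_map false) //.
  by rewrite (nth_map false).
- move=> hi; have le_i : size y <= i by lia.
  rewrite nth_default ?size_map //; split=> // hn.
  have lt_n : i - size y < n by lia.
  by rewrite map_cat nth_cat size_map ltnNge le_i /= map_nseq nth_nseq lt_n.
Qed.

(** * The race of two programs *)

Section Race.
Variables (JP JV G : finType) (C : nat).
Variables (P N : program JP G) (V : program JV G).

Definition sum_tapes (tp : JP -> tape G) (tv : JV -> tape G) : JP + JV -> tape G :=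
  fun j => match j with inl i => tp i | inr i => tv i end.

Definition sum_actions (a : JP -> symbol G * move) (b : JV -> symbol G * move) :
  JP + JV -> symbol G * move := fun j => match j with inl i => a i | inr i => b i end.

(* [P] and [V] run in parallel on disjoint tapes, [V] being slowed down by the
   factor [C.+1].  If [P] halts first then [N] takes over on the tapes of [P],
   otherwise the outcome is that of [V]. *)
Definition race : program (JP + JV)%type G :=
  @Program (JP + JV)%type G ((pstate P * pstate V * 'I_C.+1) + pstate N)%type
    (inl (pstart P, pstart V, ord0))
    (fun q => match q with inl (p, v, _) => ~~ phalt p && phalt v | inr q => phalt q end)
    (fun q => match q with inl (p, v, _) => pacc v | inr q => pacc q end)
    (fun q rd => match q with
      | inl (p, v, i) =>
        if phalt p then (inr (pstart N), idle rd) else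
        let a := pdelta p (rd \o inl) in
        if i == ord_max then
          let b := pdelta v (rd \o inr) in
          (inl (a.1, b.1, ord0), sum_actions a.2 b.2)
        else (inl (a.1, v, inord i.+1), sum_actions a.2 (idle (rd \o inr)))
      | inr q => let a := pdelta q (rd \o inl) in
        (inr a.1, sum_actions a.2 (idle (rd \o inr)))
      end).

Lemma act_on_sum tp tv a b :
  act_on (sum_tapes tp tv) (sum_actions a b) = sum_tapes (act_on tp a) (act_on tv b).
Proof. by apply/funext => -[]. Qed.

Lemma scan_sum_inr tp tv : scan (sum_tapes tp tv) \o inr = scan tv.
Proof. by []. Qed.

Lemma race_run tp tv n :
  (forall i, i < n -> ~~ phalt (run i (pstart P, tp)).1) ->
  (forall i, i * C.+1 < n -> ~~ phalt (run i (pstart V, tv)).1) ->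
  run n (pstart race, sum_tapes tp tv) =
  let cp := run n (pstart P, tp) in let cv := run (n %/ C.+1) (pstart V, tv) in
  (inl (cp.1, cv.1, inord (n %% C.+1)), sum_tapes cp.2 cv.2).
Proof.
elim: n => [|n IH] hp hv.
  by rewrite div0n mod0n /= (_ : inord 0 = ord0) //; apply: val_inj; rewrite /= inordK.
rewrite [LHS]run_step IH; last 2 first.
- by move=> i hi; apply: hp; lia.
- by move=> i hi; apply: hv; lia.
move: (hp n (ltnSn n)) (hv (n %/ C.+1)); rewrite run_step.
case: (run n _) => q t /= /negbTE hq hV; have {}hV := hV (leq_trunc_div n C.+1).
have hm : n %% C.+1 < C.+1 by rewrite ltn_mod.
rewrite /pstep /= hq /=.
have [e|ne] := eqVneq (n %% C.+1) C.
  have -> : inord (n %% C.+1) == ord_max :> 'I_C.+1.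
    by apply/eqP/val_inj; rewrite /= inordK.
  have -> : n.+1 %/ C.+1 = (n %/ C.+1).+1.
    by rewrite [in LHS](divn_eq n C.+1) e -addnS -mulSnr mulnK.
  have -> : n.+1 %% C.+1 = 0.
    by rewrite [in LHS](divn_eq n C.+1) e -addnS -mulSnr modnMl.
  rewrite run_step; case: (run (n %/ C.+1) _) hV => v tv1 /= /negbTE hv1.
  rewrite /pstep /= hv1 act_on_sum; congr (inl (_, _, _), _).
  by apply: val_inj; rewrite /= inordK.
have lt : (n %% C.+1).+1 < C.+1 by lia.
have -> : (inord (n %% C.+1) == ord_max :> 'I_C.+1) = false.
  by apply/negbTE; apply: contra ne => /eqP/(congr1 val) /=; rewrite inordK // => ->.
have -> : n.+1 %/ C.+1 = n %/ C.+1.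
  by rewrite [in LHS](divn_eq n C.+1) -addnS divnMDl // (divn_small lt) addn0.
have -> : n.+1 %% C.+1 = (n %% C.+1).+1.
  by rewrite [in LHS](divn_eq n C.+1) -addnS modnMDl (modn_small lt).
by rewrite inordK // (negbTE hV) act_on_sum scan_sum_inr act_on_idle.
Qed.

Lemma race_run_next n q tp tv : run n (inr q : pstate race, sum_tapes tp tv) =
  (inr (run n (q, tp)).1, sum_tapes (run n (q, tp)).2 tv).
Proof.
elim: n => // n; rewrite !run_step => ->; case: (run n _) => q1 t1.
by rewrite /pstep /=; case: ifP => // _; rewrite act_on_sum scan_sum_inr act_on_idle.
Qed.

(** [V] is faithful to the true run, given by [mh] and [ma], only up to time [n]. If [V] halts
    first, after [s] of its own steps, then [s * C.+1 < nP] forces [s <= n], so its verdict is right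
    and [s <= h]. Otherwise [P] needs at most [C.+1 * h] steps, and [N] adds [h] steps and a
    handover. *)
Lemma exec_race tp tv nP tP n (mh ma : nat -> bool) h b t2 :
  reach P tp nP tP -> nP <= C.+1 * n.+1 ->
  (forall s, s <= n -> phalt (run s (pstart V, tv)).1 = mh s /\
                       pacc (run s (pstart V, tv)).1 = ma s) ->
  (forall s, mh s -> s <= h -> ma s = ma h) -> mh h -> ma h = b ->
  exec N tP h b t2 ->
  exists t', exec race (sum_tapes tp tv) (C.+2 * h + 1) b t'.
Proof.
move=> [_ [qP [eP hP _]]] le_nP hV hma hh <- hN.
have exP : exists n, phalt (run n (pstart P, tp)).1 by exists nP; rewrite eP.
case: (ex_minnP exP) => m hm min_m {exP}.
have le_m : m <= nP by apply: min_m; rewrite eP.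
have em : run m (pstart P, tp) = (qP, tP) by rewrite -eP (run_halted_le hm).
have notP i : i < m -> ~~ phalt (run i (pstart P, tp)).1.
  by move=> lt_i; apply/negP => /min_m; rewrite leqNgt lt_i.
have [exV|noV] := pselect (exists s, phalt (run s (pstart V, tv)).1 && (s * C.+1 < m)).
  case: (ex_minnP exV) => s /andP[hs lt_s] min_s {exV}.
  have le_sn : s <= n by nia.
  have [es1 es2] := hV s le_sn; have mhs : mh s by rewrite -es1.
  have le_sh : s <= h.
    rewrite leqNgt; apply/negP => lt_hs.
    have : s <= h by apply: min_s; rewrite (hV h _).1 ?hh /=; nia.
    by lia.
  exists (run (s * C.+1) (pstart race, sum_tapes tp tv)).2.
  apply: (@exec_le _ _ _ _ (s * C.+1)); last by nia.
  have notP' i : i < s * C.+1 -> ~~ phalt (run i (pstart P, tp)).1.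
    by move=> hi; apply: notP; lia.
  have notV i : i * C.+1 < s * C.+1 -> ~~ phalt (run i (pstart V, tv)).1.
    move=> hi; apply/negP => hi'; have : s <= i by apply: min_s; rewrite hi' /=; nia.
    by nia.
  have er := race_run notP' notV.
  rewrite er /= mulnK //; eexists; split; first by rewrite er /= mulnK.
    by rewrite /= hs andbT; apply: notP.
  by rewrite /= es2 hma.
case: hN => qN [eN hN aN].
exists (sum_tapes t2 (run (m %/ C.+1) (pstart V, tv)).2).
(* If [h <= n], a later end of [P] would have let [V] win at time [h]; if [n < h], the bound on [nP]
   suffices. *)
have le_mh : m <= C.+1 * h.
  have [le_hn|lt_nh] := leqP h n; last by nia.
  rewrite leqNgt; apply/negP => lt_h; apply: noV; exists h.
  by rewrite (hV h le_hn).1 hh mulnC.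
apply: (@exec_le _ _ _ _ (m + h.+1)); last by nia.
exists (inr qN); split=> //; rewrite runD race_run //; last first.
  by move=> i hi; apply/negP => hi'; apply: noV; exists i; rewrite hi' hi.
by rewrite em runS /pstep /= hP /= act_on_idle race_run_next eN.
Qed.

End Race.

Lemma sim_tape_refl G (t : tape G) : sim_tape id t t.
Proof. by move=> i; case: (cells t _) => [[]|]. Qed.

Lemma sim_init_tapes k (G G' : finType) (e : G -> G') x (t : 'I_k.+1 -> tape G') :
  rep (t ord0) [::] (bits x) -> (forall j, j != ord0 -> rep (t j) [::] [::]) ->
  forall j, sim_tape e (init_tapes G x j) (t j).
Proof.
move=> h0 h j; rewrite /init_tapes; have [->|ne] := eqVneq j ord0.
  exact: rep_sim_word.
by apply: rep_sim_blank; apply: h.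
Qed.

Lemma sim_word_rep (G G' : finType) (e : G -> G') x t : sim_tape e (word_tape G x) t ->
  rep t [::] (bits x).
Proof. by move=> h; have := sim_rep h (rep_word G x); rewrite emb_bits. Qed.

Definition pad_word (g : nat -> nat) (y : seq bool) : seq bool :=
  y ++ true :: nseq (g (size y) - size y - 1) false.

(** Separates what [prepare] writes from the zeros, which are written by [pad_prog] or supplied
    lazily. *)
Lemma pad_wordE g y :
  pad_word g y = rcons y true ++ nseq (g (size y) - size (rcons y true)) false.
Proof. by rewrite /pad_word cat_rcons size_rcons -subnDA addn1. Qed.

Section InitialTape.
Variables (J : finType) (j0 : J).

(* Sends [j0] to the input tape; one tape of the target remains unused. *)
Definition input_first (j : J) : 'I_#|J|.+1 :=
  if j == j0 then ord0 else lift ord0 (enum_rank j).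

Lemma input_first_inj : injective input_first.
Proof.
move=> i j; rewrite /input_first; case: eqP => [->|_]; case: eqP => [->|_] // h.
exact: enum_rank_inj (lift_inj h).
Qed.

End InitialTape.

(** * Assembling the decider *)

Section Decider.
Variables (MR MG MM : dtm) (C : nat).

Let JR := 'I_(d_k MR).+1.
Let JG := 'I_(d_k MG).+1.
Let JM := 'I_(d_k MM).+1.
Let S : finType := ((d_sym MR + d_sym MG) + (d_sym MM + unit))%type.

(** The output tape of [MG] becomes the counter and the input tape of [MM] receives the padding, so
    nothing is copied in between. *)
Definition padder : program (JG + JM)%type S :=
  pseq (plift inl (inl \o inr) (prog_of_dtm MG))
       (pad_prog S (inl ord_max) (inr ord0)).

Definition final_run : program (JG + JM)%type S :=
  plift inr (inr \o inl) (prog_of_dtm MM).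

Definition lazy_final_run : program JM S :=
  plift id inr (lazy_prog (prog_of_dtm MM) ord0).

(** The second [JM] holds the tapes of the lazy run. The slowdown [(C + 19).+1] covers [C] for [MG],
    18 for [pad_prog] and the handover between them. *)
Definition main_prog : program (JR + ((JG + JM) + JM))%type S :=
  pseq (plift inl (inl \o inl) (prog_of_dtm MR))
    (pseq (prepare S (inl ord_max) (inr (inl (inr ord0))) (inr (inr ord0))
             (inr (inl (inl ord0))))
       (plift inr id (race (C + 19) padder final_run lazy_final_run))).

Definition decider : dtm :=
  dtm_of_prog (plift (@input_first _ (inl ord0)) id main_prog).

Lemma reach_padder (tp : JG + JM -> tape S) g y s :
  s <= C * (g (size y)).+1 ->
  outputs MG (binary (size y)) (binary (g (size y))) s ->
  rep (tp (inl ord0)) [::] (bits (binary (size y))) ->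
  (forall j, j != ord0 -> rep (tp (inl j)) [::] [::]) ->
  rep (tp (inr ord0)) [::] (bits (rcons y true)) ->
  (forall j, j != ord0 -> rep (tp (inr j)) [::] [::]) ->
  exists t', [/\ reach padder tp ((C + 19).+1 * (g (size y)).+1) t',
    rep (t' (inr ord0)) [::] (bits (pad_word g y)) &
    forall j, j != ord0 -> rep (t' (inr j)) [::] [::]].
Proof.
move=> le_s [hs os] c0 cj m0 mj.
have ex : exec (prog_of_dtm MG) (init_tapes (d_sym MG) (binary (size y))) s
    (d_accepting (cstate (d_run MG (binary (size y)) s)))
    (ctapes (d_run MG (binary (size y)) s)).
  by eexists; split; first exact: run_prog_of_dtm.
have [|t1 [h1 s1 o1]] := exec_lift (e := inl \o inr : _ -> S) (inl_inj (B := JM)) _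
   (@sim_init_tapes _ _ _ (inl \o inr) _ (tp \o inl) c0 cj) ex.
  by move=> ? ? [].
have c1 : rep (t1 (inl ord_max)) [::] (bits (binary (g (size y)))).
  by move: (s1 ord_max); rewrite os; apply: sim_word_rep.
have o1' j : t1 (inr j) = tp (inr j) by apply: o1.
have m1 : rep (t1 (inr ord0)) [::] (bits (rcons y true)) by rewrite o1'.
have [|t2 [h2 o2 m2]] := reach_pad _ c1 m1; first by [].
exists t2; split.
- by apply: reach_le (reach_seq (exec_reach h1) h2) _; nia.
- by rewrite pad_wordE.
- by move=> j ne; rewrite o2 ?o1' //; apply: mj.
Qed.

(** No term in [g (size y)] appears, because the race ends in time proportional to [h]. The final 3
    counts two handovers and the extra step of [exec_race]. *)
Lemma decider_run g y x s h :
  (exists2 s, s <= C * (g (size y)).+1 &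
    outputs MG (binary (size y)) (binary (g (size y))) s) ->
  outputs MR x y s -> halts_within MM (pad_word g y) h ->
  let n := s + (2 * size y ^ 2 + 30 * size y + 50) + (C + 21) * h + 3 in
  halts_within decider x n /\ d_accepting (cstate (d_run decider x n)) =
    d_accepting (cstate (d_run MM (pad_word g y) h)).
Proof.
move=> [sG le_sG oG] [hs os] hh n.
pose t0 := (fun j => if j == inl ord0 then word_tape S x else blank_tape S)
  : JR + ((JG + JM) + JM) -> tape S.
have ex : exec (prog_of_dtm MR) (init_tapes (d_sym MR) x) s
    (d_accepting (cstate (d_run MR x s))) (ctapes (d_run MR x s)).
  by eexists; split; first exact: run_prog_of_dtm.
have [||t1 [h1 s1 o1]] := exec_lift (e := inl \o inl : _ -> S) (t' := t0)
    (inl_inj (B := ((JG + JM) + JM)%type)) _ _ ex.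
- by move=> ? ? [].
- apply: (@sim_init_tapes _ _ _ (inl \o inl) _ (t0 \o inl)) => [|j ne].
    exact: rep_word.
  rewrite /t0 /= (_ : (inl j == inl ord0 :> _ + _) = (j == ord0)) // (negbTE ne).
  exact: rep_blank.
have y1 : rep (t1 (inl ord_max)) [::] (bits y).
  by move: (s1 ord_max); rewrite os; apply: sim_word_rep.
have b1 j : rep (t1 (inr j)) [::] [::] by rewrite o1 //; apply: rep_blank.
have [|t2 [h2 o2 m2 v2 c2]] := @reach_prepare _ S (inl ord_max) (inr (inl (inr ord0)))
  (inr (inr ord0)) (inr (inl (inl ord0))) _ t1 y y1 (b1 _) (b1 _) (b1 _).
  by [].
pose tp := t2 \o inr \o inl; pose tv := t2 \o inr \o inr.
have bp j : j != ord0 -> rep (tp (inl j)) [::] [::].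
  move=> ne; rewrite /tp /= o2 //.
  by rewrite !inE /= (_ : (inr (inl (inl j)) == inr (inl (inl ord0)) :> _ + (_ + _ + _)) = (j == ord0)).
have bm j : j != ord0 -> rep (tp (inr j)) [::] [::].
  move=> ne; rewrite /tp /= o2 //.
  by rewrite !inE /= (_ : (inr (inl (inr j)) == inr (inl (inr ord0)) :> _ + (_ + _ + _)) = (j == ord0)) // orbF.
have bv j : j != ord0 -> rep (tv j) [::] [::].
  move=> ne; rewrite /tv /= o2 //.
  by rewrite !inE /= (_ : (inr (inr j) == inr (inr ord0) :> _ + (_ + _ + _)) = (j == ord0)) // orbF.
have [tP [hP mP bP]] := reach_padder le_sG oG c2 bp m2 bm.
set z := pad_word g y in hh *.
have exM : exec (prog_of_dtm MM) (init_tapes (d_sym MM) z) h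
    (d_accepting (cstate (d_run MM z h))) (ctapes (d_run MM z h)).
  by eexists; split; first exact: run_prog_of_dtm.
have [|tN [hN _ _]] := exec_lift (e := inr \o inl : _ -> S) (inr_inj (A := JG)) _
   (@sim_init_tapes _ _ _ (inr \o inl) _ (tP \o inr) mP bP) exM.
  by move=> ? ? [].
(* The padded word has length at least [g (size y)], so up to this time the lazy zeros cannot be
   told from the true padding. *)
have hV i : i <= g (size y) ->
    phalt (run i (pstart lazy_final_run, tv)).1 = d_halting (cstate (d_run MM z i)) /\
    pacc (run i (pstart lazy_final_run, tv)).1 = d_accepting (cstate (d_run MM z i)).
  move=> le_i.
  have ei : injective (inr : d_sym MM + unit -> S) by move=> ? ? [].
  have ii : injective (id : JM -> JM) by [].
  have [t' [e _ _]] := plift_run (J := JM) (J' := JM) ii ei i (pstart (lazy_prog (prog_of_dtm MM) ord0))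
    (sim_init_tapes inr v2 bv).
  rewrite e /=.
  have := @lazy_run_word _ _ (prog_of_dtm MM) (rcons y true)
    (g (size y) - size (rcons y true)) i.
  rewrite -pad_wordE run_prog_of_dtm size_rcons => /(_ isT) -> //.
  by lia.
have [||||t3 h3] := @exec_race _ _ _ _ padder final_run lazy_final_run tp tv _ tP (g (size y))
  (fun i => d_halting (cstate (d_run MM z i))) (fun i => d_accepting (cstate (d_run MM z i)))
  h (d_accepting (cstate (d_run MM z h))) tN hP (leqnn _) hV.
- move=> i hi le_i; have := @run_halted_le _ _ (prog_of_dtm MM) i h (d_start MM, init_tapes (d_sym MM) z).
  by rewrite !run_prog_of_dtm => /(_ hi le_i) [->].
- exact: hh.
- by [].
- exact: hN.
have e2 : sum_tapes tp tv = t2 \o inr by apply/funext => -[[]|].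
rewrite e2 in h3.
have [|||t4 [h4 _ _]] := exec_lift (io := inr : _ -> JR + ((JG + JM) + JM)) (e := id) (t' := t2)
   _ _ _ h3.
- exact: inr_inj.
- by [].
- by move=> j; apply: sim_tape_refl.
have h5 : exec main_prog t0 _ _ _ := exec_seq (exec_reach h1) (exec_seq h2 h4).
have [|||t6 [h6 _ _]] := exec_lift (io := @input_first _ (inl ord0)) (e := id)
   (t' := init_tapes S x) _ _ _ h5.
- exact: input_first_inj.
- by [].
- move=> j; rewrite /t0 /init_tapes /input_first; case: eqP => _; last exact: sim_tape_refl.
  by rewrite eqxx; apply: sim_tape_refl.
by apply: exec_dtm_of_prog (exec_le h6 _); rewrite /n; lia.
Qed.

End Decider.

(** * Resource bounds *)

Lemma d_run_halted M x m n : halts_within M x m -> m <= n -> d_run M x n = d_run M x m.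
Proof.
move=> h /subnK <-; rewrite /d_run iterD -/(d_run M x m).
by elim: (n - m) => //= k ->; rewrite /d_step h.
Qed.

Lemma d_run_halted_eq M x m n : halts_within M x m -> halts_within M x n ->
  d_run M x m = d_run M x n.
Proof.
by move=> hm hn; have [le|/ltnW le] := leqP m n; [symmetry|]; apply: d_run_halted.
Qed.

(** The head moves right by at most one cell per step; this bounds the length of an output. *)
Lemma d_run_support M x s j (i : int) : ((size x + s)%:Z <= i)%R ->
  cells (ctapes (d_run M x s) j) i = None.
Proof.
suff : (head (ctapes (d_run M x s) j) <= s%:Z)%R /\
  forall i : int, ((size x + s)%:Z <= i)%R -> cells (ctapes (d_run M x s) j) i = None.
  by case=> _; apply.
elim: s {i} => [|s [IHh IHc]].
  rewrite addn0 /d_run /=; case: eqP => _ //=; split=> // -[i|i] //= hi.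
  by rewrite nth_default // size_map; lia.
rewrite /d_run iterS -/(d_run M x s) /d_step; case: ifP => _.
  by split=> [|i hi]; [lia | apply: IHc; lia].
set a := d_delta _ _; rewrite /=.
have sh : (shift (on_tape a j).2 <= 1)%R by case: (_.2).
split=> [|i hi]; first by lia.
by case: eqP => [e|_]; [lia | apply: IHc; lia].
Qed.

Lemma outputs_size M x y s : outputs M x y s -> size y <= size x + s.
Proof.
case=> _ e; rewrite leqNgt; apply/negP => lt.
have := @d_run_support M x s ord_max (Posz (size x + s)) (lexx _).
by rewrite e /= (nth_map false).
Qed.

Lemma time_constructible_bound g : time_constructible g -> exists (M : dtm) (C : nat),
  forall n, exists2 s, s <= C * (g n).+1 & outputs M (binary n) (binary (g n)) s.
Proof.
case=> M [ho [C [N _ hC]]]; have [s hs] := choice ho.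
(* The finitely many small inputs are absorbed into the constant. *)
exists M, (C + \max_(n < N) s n)%N => n; have [hh os] := hs n.
have [le_Nn|lt_nN] := leqP N n.
  have hCn : halts_within M (binary n) (C * g n) by apply: hC.
  exists (C * g n)%N; first by nia.
  by split=> //; rewrite (d_run_halted_eq hCn hh).
exists (s n) => //; have := @leq_bigmax _ (fun n : 'I_N => s n) (Ordinal lt_nN).
by rewrite /=; nia.
Qed.

(** * Padded words and density *)

Section PadWords.
Variable g : nat -> nat.

Lemma zeros_suffix_inj x1 x2 m1 m2 :
  x1 ++ true :: nseq m1 false = x2 ++ true :: nseq m2 false -> x1 = x2.
Proof.
move/(congr1 rev); rewrite !rev_cat !rev_cons !rev_nseq !cat_rcons.
elim: m1 m2 => [|m1 IH] [|m2] //=; last by case=> /IH.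
by case=> /(can_inj revK).
Qed.

Lemma pad_pad_word A x : pad A g (pad_word g x) <-> A x.
Proof.
split=> [[x' Ax' e]|Ax]; last by exists x.
by rewrite (zeros_suffix_inj e).
Qed.

Lemma leq_size_pad_word x : g (size x) <= size (pad_word g x).
Proof. by rewrite size_cat /= size_nseq; lia. Qed.

Lemma size_pad_word x : size x < g (size x) -> size (pad_word g x) = g (size x).
Proof. by rewrite size_cat /= size_nseq; lia. Qed.

End PadWords.

Lemma bval_rcons_lt x : bval (rcons x true) < 2 ^ (size x).+1.
Proof.
elim: x => //= b x; rewrite [in X in _ -> X]expnS.
by move: (2 ^ _) (bval _) => p v; case: b => /=; lia.
Qed.

(** The appended one is the top binary digit, so words of different lengths get different values. *)
Lemma bval_rcons_inj : injective (fun x => bval (rcons x true)).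
Proof.
have gt0 x : 0 < bval (rcons x true) by elim: x => //= b x; lia.
elim=> [|a x IH] [|b y] //=; [have := gt0 y; case: b; lia | have := gt0 x; case: a; lia|].
move=> e; have eab : a = b by case: a b e => [] []; lia.
by rewrite eab in e *; congr cons; apply: IH; lia.
Qed.

Local Open Scope classical_set_scope.

(** There are [2 ^ k.+1 - 1] words of length at most [k], whence the successor in the exponent of
    the density bound. *)
Lemma card_words_le k : ([set x : seq bool | (size x <= k)%N] #<= `I_(2 ^ k.+1))%card.
Proof.
set X := [set x | _].
have := @inj_card_eq _ _ X (fun x => bval (rcons x true)) (in2W bval_rcons_inj).
rewrite card_eq_le => /andP[_ h]; apply: (card_le_trans h).
apply: subset_card_le => _ [x /= hx <-] /=.
by apply: leq_trans (bval_rcons_lt x) _; rewrite leq_exp2l.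
Qed.

Lemma pad_in_D A g f : nondecreasing_nat f -> (forall n, n <= f (g n)) ->
  D (fun n => 2 ^ (f n).+1) (pad A g).
Proof.
move=> f_nd fg; exists 0 => // n _ /=.
apply: card_le_trans (card_words_le (f n)).
apply: card_le_trans (card_image_le (pad_word g) _).
apply: subset_card_le => _ [[x Ax ->] hx] /=; exists x => //=.
apply: leq_trans (fg _) _; apply: f_nd; apply: leq_trans hx.
exact: leq_size_pad_word.
Qed.

Local Open Scope ring_scope.

(** * Growth of the form 2^(n^o(1)) *)

Section Asymptotics.
Variable R : realType.
Implicit Types (d : R) (F : nat -> nat).

Lemma near_le_powR d (a : R) : 0 < d -> \forall n \near \oo, a <= n%:R `^ d.
Proof.
move=> d0; set b := Num.max a 1.
have b1 : 1 <= b by rewrite le_max lexx orbT.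
have b0 : 0 <= b by lra.
apply: filterS (nbhs_infty_ger (b `^ d^-1)) => n hn.
apply: (@le_trans _ _ b); first by rewrite le_max lexx.
have eb : b = (b `^ d^-1) `^ d by rewrite -powRrM mulVf ?powRr1 // gt_eqF.
rewrite [leLHS]eb.
by apply: ge0_ler_powR; rewrite ?nnegrE ?powR_ge0 ?ler0n //; apply: ltW.
Qed.

Lemma ln2_gt0 : 0 < ln (2 : R).
Proof. by apply: ln_gt0; lra. Qed.

Lemma two_powRE (x : R) : 2 `^ x = expR (x * ln 2).
Proof. by rewrite /powR; case: eqP => // h; lra. Qed.

(** Take logarithms and let [y] be [n ^ (d / 2)]. Then [ln n <= y / (d / 2)], and eventually
    [k / (d / 2) <= y * ln 2], so [k * ln n <= y * y * ln 2]. *)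
Lemma near_poly_le_two_powR d k : 0 < d ->
  \forall n \near \oo, n%:R ^+ k <= 2 `^ (n%:R `^ d) :> R.
Proof.
move=> d0; have d20 : 0 < d / 2 by lra.
have := near_le_powR (k%:R / (d / 2) / ln 2) d20; have := nbhs_infty_ger (1 : R).
apply: filterS2 => n n1 hn; have n0 : 0 < n%:R :> R by lra.
rewrite -[leLHS](lnK (x := _ ^+ k)) ?posrE ?exprn_gt0 // two_powRE ler_expR lnXn //.
set y := n%:R `^ (d / 2) in hn *.
have y0 : 0 < y by apply: powR_gt0.
have -> : n%:R `^ d = y * y.
  rewrite /y -powRD; last by rewrite [n%:R == 0]gt_eqF // implybT.
  by congr powR; lra.
have hl : ln n%:R * (d / 2) <= y by rewrite mulrC -ln_powR ltW // ln_sublinear.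
move: hn; rewrite !ler_pdivrMr ?ln2_gt0 // => hn.
rewrite -[ln _ *+ k]mulr_natr -(ler_pM2r d20).
apply: (@le_trans _ _ (y * k%:R)); first by rewrite mulrAC ler_wpM2r.
rewrite (_ : y * y * ln 2 * (d / 2) = y * (y * ln 2 * (d / 2))); last by ring.
by rewrite ler_wpM2l // ltW.
Qed.

(** All the bounds, one for each [d], are merged into one function: [eps n] solves 2^(n^eps) = F n +
    2. The summand 2 keeps the inner logarithm at least 1, hence [eps n] nonnegative. *)
Lemma two_pow_o1_bound F :
  (forall d, 0 < d -> \forall n \near \oo, (F n)%:R + 2 <= 2 `^ (n%:R `^ d) :> R) ->
  exists2 eps : nat -> R, eps @ \oo --> (0 : R) &
    \forall n \near \oo, (F n)%:R <= 2 `^ (n%:R `^ eps n).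
Proof.
move=> hF; pose L n := ln ((F n)%:R + 2 : R) / ln 2.
have F0 n : 0 < (F n)%:R + 2 :> R by have := ler0n R (F n); lra.
have L1 n : 1 <= L n.
  by rewrite ler_pdivlMr ?ln2_gt0 // mul1r ler_ln ?posrE //; have := ler0n R (F n); lra.
have L0 n : 0 < L n by have := L1 n; lra.
exists (fun n => ln (L n) / ln n%:R).
  apply/cvgr0Pnorm_le => d d0; have := hF d d0; have := nbhs_infty_ger (2 : R).
  apply: filterS2 => n n2 hn; have ln_n : 0 < ln n%:R :> R by apply: ln_gt0; lra.
  rewrite ger0_norm; last by apply: divr_ge0; [apply: ln_ge0 | apply: ltW].
  rewrite ler_pdivrMr // -ln_powR ler_ln ?posrE //; last by apply: powR_gt0; lra.
  by rewrite ler_pdivrMr ?ln2_gt0 // -ln_powR ler_ln ?posrE // powR_gt0.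
apply: filterS (nbhs_infty_ger (2 : R)) => n n2.
have ln_n : 0 < ln n%:R :> R by apply: ln_gt0; lra.
have -> : n%:R `^ (ln (L n) / ln n%:R) = L n.
  rewrite /powR; case: eqP => [|_]; first by lra.
  by rewrite divfK ?gt_eqF // lnK ?posrE.
rewrite two_powRE divfK ?gt_eqF ?ln2_gt0 // lnK ?posrE //.
by lra.
Qed.

End Asymptotics.

(** * Transfer of hardness *)

Section Hardness.
Variables (R : realType) (g : nat -> nat).
Hypotheses (g_incr : strictly_increasing g) (g_sup : super_polynomial R g).

Lemma leq_strictly_increasing n : (n <= g n)%N.
Proof. by elim: n => // n IH; apply: leq_ltn_trans IH _; apply: g_incr. Qed.

Lemma near_ltn_super_polynomial : \forall n \near \oo, (n < g n)%N.
Proof.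
have := g_sup (ltr0n R 2); have := nbhs_infty_ger (2 : R).
apply: filterS2 => n n2; rewrite powR_mulrn // -(ltr_nat R) => hn.
by apply: lt_le_trans hn; rewrite expr2; nra.
Qed.

(** The bound holds for every [y], short ones being absorbed into [K], because a reduction may send
    long words to short ones. *)
Lemma pad_word_halting_time (M : dtm) (L : language) (C : R) (T : nat -> nat) :
  decides M L ->
  (\forall n \near \oo, forall x : seq bool, size x = n ->
     exists2 s : nat, s%:R <= C * (T n)%:R & halts_within M x s) ->
  is_two_pow_n_pow_o1 (fun n => (T (g n))%:R : R) ->
  exists2 h : seq bool -> nat, forall y, halts_within M (pad_word g y) (h y) &
    forall d : R, 0 < d -> exists K : nat,
      forall y, (h y)%:R <= K%:R * 2 `^ ((size y)%:R `^ d).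
Proof.
move=> decM [N1 _ hN1] [eps [eps0 hT]].
have ex y : exists n, d_halting (cstate (d_run M (pad_word g y) n)).
  by have [s hs _] := decM (pad_word g y); exists s.
pose h y := ex_minn (ex y).
exists h => [y|d d0]; first by rewrite /h; case: ex_minnP.
have h_min y n : halts_within M (pad_word g y) n -> (h y <= n)%N.
  by rewrite /h; case: ex_minnP => m _ min_m /min_m.
have /cvgr0Pnorm_le/(_ d d0) he := eps0.
(* [n < g n] makes the padded word exactly [g n] long, [N1 <= n] brings this length into the range
   of the time bound, and [1 <= n] makes powers of [n] monotone in the exponent. *)
have [N _ hN] : \forall n \near \oo, [/\ (n < g n)%N,
    (T (g n))%:R = 2 `^ (n%:R `^ eps n) :> R, `|eps n| <= d & (maxn N1 1 <= n)%N].
  near=> n; split; near: n => //; first exact: near_ltn_super_polynomial.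
  exact: nbhs_infty_ge.
exists (Num.bound `|C| + \max_(y : N.-bseq bool) h y)%N => y.
have p1 : 1 <= 2 `^ ((size y)%:R `^ d) :> R.
  by rewrite -[leLHS](powRr0 2) ler_powR ?powR_ge0 // ler1n.
have [le_N|lt_N] := leqP N (size y); last first.
  apply: (@le_trans _ _ (\max_(y : N.-bseq bool) h y)%:R).
    by rewrite ler_nat; apply: (leq_bigmax (Bseq (ltnW lt_N))).
  rewrite natrD -[leLHS]mulr1; apply: ler_pM => //.
  by rewrite lerDr.
have [lt_g eT le_eps] := hN _ le_N; rewrite geq_max => /andP[le_N1 n1].
have [|s hs hh] := hN1 (g (size y)) _ (pad_word g y) (size_pad_word lt_g).
  exact: leq_trans le_N1 (leq_strictly_increasing _).
apply: (@le_trans _ _ s%:R); first by rewrite ler_nat h_min.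
apply: (le_trans hs); rewrite eT.
apply: (@le_trans _ _ (`|C| * 2 `^ ((size y)%:R `^ eps (size y)))).
  by rewrite ler_wpM2r ?powR_ge0 // ler_norm.
apply: ler_pM; rewrite ?powR_ge0 ?normr_ge0 //.
  by rewrite natrD (le_trans (ltW (archi_boundP (normr_ge0 C)))) // lerDl.
rewrite ler_powR ?ler1n // ler_powR ?ler1n //.
exact: le_trans (ler_norm _) le_eps.
Unshelve. all: by end_near.
Qed.

Lemma poly_le_expn e m : (88 + e <= m)%N -> (m + (m ^ e + e) <= m ^ (e + 2))%N.
Proof.
move=> hm; have E1 : (0 < m ^ e)%N by rewrite expn_gt0; lia.
rewrite expnD -[(m ^ 2)%N]/(m * m)%N; move: (m ^ e)%N E1 => [|E] // _.
have hmm : (88 * m <= m * m)%N by rewrite leq_mul2r; lia.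
rewrite mulSn; move: (m * m)%N hmm => Q hQ.
have : (E <= E * Q)%N by rewrite leq_pmulr //; lia.
by lia.
Qed.

Lemma poly_time_bound e m s y h C : (s <= m ^ e + e)%N -> (y <= m + s)%N ->
  (88 + e <= m)%N ->
  (s + (2 * y ^ 2 + 30 * y + 50) + (C + 21) * h + 3 + 2 <=
   m ^ (2 * e + 5) + (C + 21) * h)%N.
Proof.
move=> hs hy hm.
have hP := poly_le_expn hm.
have ek : (m ^ (2 * e + 5) = m * (m ^ (e + 2) * m ^ (e + 2)))%N.
  by rewrite -expnD -expnS; congr expn; lia.
rewrite {}ek -[(y ^ 2)%N]/(y * y)%N; move: (m ^ (e + 2))%N hP => P hP.
have hyP : (y <= P)%N by lia.
have hsP : (s <= P)%N by lia.
have P1 : (0 < P)%N by lia.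
have hyy : (y * y <= P * P)%N by apply: leq_mul.
have hPP : (P <= P * P)%N by nia.
(* With [s] and [y] at most [P], the terms other than the one in [h] add up to at most
   [(1 + 2 + 30 + 55) * (P * P)], which one factor [m] absorbs. *)
have hmP : (88 * (P * P) <= m * (P * P))%N by rewrite leq_mul2r; lia.
by lia.
Qed.

Lemma reducible_two_pow_o1 (A B : language) (T : nat -> nat) :
  time_constructible g -> poly_many_one_reducible B A ->
  is_two_pow_n_pow_o1 (fun n => (T (g n))%:R : R) ->
  DTIME (fun n => (T n)%:R : R) (pad A g) -> DTIME_two_pow_n_pow_o1 R B.
Proof.
move=> /time_constructible_bound[MG [CG hG]] [r [MR [e hR]] hr] hT [M [decM [C hC]]].
have [h hh h_bound] := pad_word_halting_time decM hC hT.
have {}hR x : exists s, (s <= size x ^ e + e)%N /\ outputs MR x (r x) s.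
  by have [s ? ?] := hR x; exists s.
have [s hs] := choice hR.
pose y x := size (r x).
pose time x := (s x + (2 * y x ^ 2 + 30 * y x + 50) + (CG + 21) * h (r x) + 3)%N.
pose N := decider MR MG M CG.
have run_time x : halts_within N x (time x) /\
    d_accepting (cstate (d_run N x (time x))) =
    d_accepting (cstate (d_run M (pad_word g (r x)) (h (r x)))).
  exact: decider_run (hG _) (hs x).2 (hh _).
pose F n := (\max_(x : n.-tuple bool) time x)%N.
have [|eps eps0 hF] := @two_pow_o1_bound R F.
  move=> d d0.
  (* As [r x] has length at most [m ^ (e + 2)], its power [d'] is at most [m ^ (d / 2)]. *)
  pose d' := d / 2 / (e + 2)%:R.
  have d'0 : 0 < d' by rewrite !divr_gt0 // ltr0n addn2.
  have [K hK] := h_bound d' d'0.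
  have d20 : 0 < d / 2 by lra.
  have n1 := nbhs_infty_ge (88 + e).
  have n2 := near_le_powR 2 d20.
  have n3 := nbhs_infty_ger (1 + ((CG + 21) * K)%:R : R).
  have n4 := near_poly_le_two_powR (2 * e + 5) d20.
  have n5 := near_poly_le_two_powR 1 d20.
  apply: filterS2 (filterI n1 (filterI n2 n3)) (filterI n4 n5) => m [m1 [m2 m3]] [m4 m5].
  have [x ->] : {x : m.-tuple bool | F m = time x}.
    by apply: (@bigop.eq_bigmax _ (fun x : m.-tuple bool => time x)); rewrite card_tuple card_bool expn_gt0.
  have hy : (y x <= m + s x)%N by have := outputs_size (hs x).2; rewrite size_tuple.
  have hsx : (s x <= m ^ e + e)%N by have := (hs x).1; rewrite size_tuple.
  have := poly_time_bound (h (r x)) CG hsx hy m1; rewrite -/(time x) -(ler_nat R) natrD.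
  move/le_trans; apply; rewrite natrD natrX.
  set X := m%:R `^ (d / 2) in m2 m4 m5 *.
  have y_le : (y x <= m ^ (e + 2))%N.
    by have := poly_le_expn m1; lia.
  have hX : 2 `^ ((y x)%:R `^ d') <= 2 `^ X :> R.
    rewrite ler_powR ?ler1n // /X.
    have -> : m%:R `^ (d / 2) = (m ^ (e + 2))%:R `^ d' :> R.
      rewrite natrX -powR_mulrn // -powRrM /d' [(e + 2)%:R * _]mulrC divfK //.
      by rewrite pnatr_eq0 addn2.
    by apply: ge0_ler_powR; rewrite ?nnegrE ?ler_nat //; apply: ltW.
  have hh' : ((CG + 21) * h (r x))%:R <= ((CG + 21) * K)%:R * 2 `^ X :> R.
    rewrite !natrM -mulrA ler_wpM2l //; apply: le_trans (hK (r x)) _.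
    by rewrite ler_wpM2l.
  have -> : m%:R `^ d = X * X :> R.
    rewrite /X -powRD; first by congr powR; lra.
    by rewrite pnatr_eq0 -lt0n [X in _ ==> X](_ : _ = true) ?implybT //; lia.
  (* The polynomial part is at most 2^X, and the constant factor [1 + (CG + 21) * K] is at most [m],
     hence at most 2^X. The total is thus at most 2^(X + X), and [X >= 2] gives the exponent
     [X * X]. *)
  have XX : X + X <= X * X by nra.
  apply: (@le_trans _ _ (2 `^ (X + X))); last by rewrite ler_powR ?ler1n.
  rewrite powRD; last by rewrite pnatr_eq0 implybT.
  rewrite expr1 in m5; have Z0 := powR_ge0 2 X; have m35 := le_trans m3 m5.
  by have := ler_wpM2r Z0 m35; rewrite mulrDl mul1r; lra.
exists eps => //; exists N; split=> [x|].
  exists (time x); first exact: (run_time x).1.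
  rewrite (run_time x).2 hr -(pad_pad_word g A).
  have [s' hs' <-] := decM (pad_word g (r x)).
  by rewrite (d_run_halted_eq (hh (r x)) hs').
exists 1; apply: filterS hF => n hn x sx; exists (time x); last exact: (run_time x).1.
rewrite mul1r; apply: le_trans hn; rewrite ler_nat.
have sx' : size x == n by apply/eqP.
exact: (leq_bigmax (Tuple sx')).
Qed.

End Hardness.

Theorem theorem3 (R : realType) (g f : nat -> nat)
  (g_incr : strictly_increasing g)
  (g_wsp : well_super_polynomial R g)
  (f_sub : sub_polynomial R f)
  (f_nondecr : nondecreasing_nat f)
  (fg : forall n : nat, (n <= f (g n))%N)
  (NP_hard : ~ (NP `<=` DTIME_two_pow_n_pow_o1 R)) :
  forall A : language, NP_complete A ->
    D (fun n => (2 ^ (f n).+1)%N) (pad A g) /\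
    forall T : nat -> nat,
      is_two_pow_n_pow_o1 (fun n => (T (g n))%:R : R) ->
      ~ DTIME (fun n => (T n)%:R : R) (pad A g).
Proof.
move=> A [_ A_hard]; split; first exact: pad_in_D.
move=> T hT hpad; apply: NP_hard => B /A_hard hB.
by case: g_wsp => g_sup g_tc _; apply: reducible_two_pow_o1 hB hT hpad.
Qed.
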